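(* A set $A\subseteq 2^\omega$ is Borel if and only if there are an infinite time Turing machine program $e$, a real parameter $z\in 2^\omega$ and a countable ordinal $\alpha$ such that $e$ with parameter $z$ decides $A$ and, on every input, halts in fewer than $\alpha$ steps. Similarly, a function $f\colon 2^\omega\to 2^\omega$ is Borel if and only if there are a program $e$, a real parameter $z$ and a countable ordinal $\alpha$ such that $e$ with parameter $z$ computes $f$ and, on every input, halts in fewer than $\alpha$ steps.
   Context: An infinite time Turing machine has an input tape, a work tape, an output tape (and optionally a parameter tape holding a fixed real $z\in2^\omega$), each consisting of $\omega$ many cells holding $0$ or $1$, and runs a finite program with finitely many states. Successor steps are as for ordinary Turing machines. At limit ordinal stages the head is placed on the leftmost cell, the machine enters a special limit state, and each cell takes the $\limsup$ of its previous values. The computation halts only when the halt state is reached, and its output is the content of the output tape. A function $f$ is computed by program $e$ with parameter $z$ if on each input $x$ the computation halts with output $f(x)$; a set $A$ is decided by $e$ with parameter $z$ if $e$ with parameter $z$ computes the characteristic function of $A$. *)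

(* Defs.v *)
From HB Require Import structures.
From mathcomp Require Import all_boot.
From mathcomp Require Import all_classical all_analysis.
From mathcomp Require Import wochoice.

Set Implicit Arguments.
Unset Strict Implicit.
Unset Printing Implicit Defensive.

Local Open Scope classical_set_scope.

(** * Ordinals *)

(* An ordinal [a] is represented by a well-ordered type of order type [a]; the
   elements of the type stand for the ordinals below [a]. *)
Record ordinal_type := OrdinalType {
  ord_sort :> eqType;
  ord_le : rel ord_sort;
  ord_le_wo : well_order ord_le }.

Definition countable_ordinal (a : ordinal_type) := countable [set: a].

Definition ord_lt (a : ordinal_type) (s t : a) : bool :=
  (s != t) && ord_le s t.

Definition ord_is_zero (a : ordinal_type) (t : a) : Prop :=
  forall s : a, ~~ ord_lt s t.

Definition ord_is_succ (a : ordinal_type) (s t : a) : Prop :=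
  ord_lt s t /\ forall r : a, ord_lt r t -> ord_le r s.

Definition ord_is_limit (a : ordinal_type) (t : a) : Prop :=
  ~ ord_is_zero t /\ forall s : a, ~ ord_is_succ s t.

(** * Infinite time Turing machines *)

Inductive move := MoveLeft | MoveRight | Stay.

(* [delta q (i, w, o, p)] is the instruction executed in state [q] when the head
   reads [i], [w], [o], [p] on the input, work, output and parameter tapes: the
   new state, the bits written on the input, work and output tapes, and the move
   of the head. The parameter tape holds a fixed real and is never written. *)
Record program := Program {
  pstate : finType;
  start : pstate;
  limit : pstate;
  halt : pstate;
  special_uniq : uniq [:: start; limit; halt];
  delta : pstate -> bool * bool * bool * bool ->
          pstate * (bool * bool * bool) * move }.

(* A single head reads the same position on all tapes. *)
Record config (e : program) := Config {
  cstate : pstate e;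
  chead : nat;
  cinput : cantor_space;
  cwork : cantor_space;
  coutput : cantor_space }.

Definition write (u : cantor_space) (i : nat) (b : bool) : cantor_space :=
  fun j => if j == i then b else u j.

(* A left move on the leftmost cell leaves the head in place: [0.-1 = 0]. *)
Definition move_head (m : move) (i : nat) : nat :=
  match m with MoveLeft => i.-1 | MoveRight => i.+1 | Stay => i end.

Definition init_config (e : program) (x : cantor_space) : config e :=
  Config (start e) 0 x (fun=> false) (fun=> false).

Definition step (e : program) (z : cantor_space) (c : config e) : config e :=
  let i := chead c in
  let: (q, (bi, bw, bo), m) :=
    delta (cstate c) (cinput c i, cwork c i, coutput c i, z i) in
  Config q (move_head m i)
    (write (cinput c) i bi) (write (cwork c) i bw) (write (coutput c) i bo).

(* The limsup of a sequence of bits below the limit [t]: the infimum over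
   [r < t] of the suprema over [r <= s < t]. *)
Definition limsup_bit (a : ordinal_type) (b : a -> bool) (t : a) : bool :=
  `[< forall r, ord_lt r t -> exists s, [/\ ord_le r s, ord_lt s t & b s] >].

Definition limit_config (e : program) (a : ordinal_type) (c : a -> config e)
    (t : a) : config e :=
  Config (limit e) 0
    (fun n => limsup_bit (fun s => cinput (c s) n) t)
    (fun n => limsup_bit (fun s => cwork (c s) n) t)
    (fun n => limsup_bit (fun s => coutput (c s) n) t).

(* [c t] is the configuration after [t] steps. Configurations after the first
   visit to the halt state have no meaning; [halts_at] below ignores them. *)
Definition is_run (e : program) (z x : cantor_space) (a : ordinal_type)
    (c : a -> config e) : Prop :=
  forall t : a,
    [/\ ord_is_zero t -> c t = init_config e x,
        forall s, ord_is_succ s t -> c t = step z (c s) &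
        ord_is_limit t -> c t = limit_config c t].

(* On input [x] the computation halts after exactly [t] steps with output [y]. *)
Definition halts_at (e : program) (z x : cantor_space) (a : ordinal_type)
    (t : a) (y : cantor_space) : Prop :=
  exists c : a -> config e,
    [/\ is_run z x c,
        cstate (c t) = halt e,
        forall s, ord_lt s t -> cstate (c s) <> halt e &
        coutput (c t) = y].

Definition computes (e : program) (z : cantor_space)
    (f : cantor_space -> cantor_space) : Prop :=
  forall x, exists (a : ordinal_type) (t : a), halts_at e z x t (f x).

(* The value 1 of a characteristic function is output as [1,0,0,...] and the
   value 0 as [0,0,0,...]. *)
Definition char_fun (A : set cantor_space) (x : cantor_space) : cantor_space :=
  fun n => (n == 0) && `[< A x >].

Definition decides (e : program) (z : cantor_space) (A : set cantor_space) :=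
  computes e z (char_fun A).

Definition halts_before (e : program) (z x : cantor_space) (a : ordinal_type) :
    Prop :=
  exists (t : a) (y : cantor_space), halts_at e z x t y.

(** * Borel sets and functions *)

Definition borel_cantor := g_sigma_algebraType (@open cantor_space).

Definition borel_set (A : set cantor_space) : Prop :=
  measurable (A : set borel_cantor).

Definition borel_fun (f : cantor_space -> cantor_space) : Prop :=
  measurable_fun setT (f : borel_cantor -> borel_cantor).

(* Main.v *)
From HB Require Import structures.
Require Import Defs.
From mathcomp Require Import all_boot all_classical all_analysis.
From mathcomp Require Import wochoice.
From mathcomp Require Import zify.

Set Implicit Arguments.
Unset Strict Implicit.
Unset Printing Implicit Defensive.

Local Open Scope classical_set_scope.

(* A machine run of countable length is determined, cell by cell, by countably
   many Boolean operations on the input, so the output is a Borel function of it.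

   Conversely, a Borel function is given by a well-founded countable circuit of
   infinitary NOR gates. The value of gate [g] is kept in dual-rail form: a bit
   [T g] ([F g]) is set once the gate is known to be true (false). Since these
   bits only change from 0 to 1, they survive limit stages. The parameter lists
   an infinite sequence of operations, all of which the machine carries out
   during each sweep of length omega: whenever an argument of [g] is known to be
   true, [F g] is set; whenever an argument of [g] is not known to be false, a
   flag [U g], cleared earlier in the sweep, is set. At a limit stage [U g = 0]
   thus certifies that all arguments of [g] are false, and this remains correct
   at limits of sweeps because the lim sup can only set the flag; the next sweep
   then sets [T g]. By induction along the Kleene-Brouwer order of the circuit,
   every gate is decided after boundedly many sweeps, uniformly in the input.
   The flag of a root gate that waits for all output bits tells when to halt. *)

(** * Ordinals and runs *)

(** For the first direction, [computes] and the time bound may be witnessed in unrelated ordinal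
    types, so runs must be compared along isomorphic initial segments before their outputs can be
    identified. For the converse, the lim sup sees every intermediate tape content, not only the
    results of completed operations; the simulation lemmas therefore control each single step of the
    machine. Halting can be tested only at limit stages, since no step inside a sweep has inspected
    infinitely many gates. The test reads the cell under the head, which is why the root is gate 0
    and its flag is work cell 0. NOR alone suffices as a connective because it yields complements
    and countable intersections. The time bound is a product of three factors: the Kleene-Brouwer
    order type, a factor omega that leaves room for the two sweeps a gate needs once its arguments
    are decided, and a factor omega for the steps of one sweep. *)

Section OrdinalTheory.
Variable a : ordinal_type.
Implicit Types r s t : a.

Lemma ord_min (P : a -> Prop) : (exists t, P t) ->
  exists t, P t /\ forall s, P s -> ord_le t s.
Proof.
move=> [t Pt].
have ne : nonempty [pred s | `[< P s >]] by exists t; exact/asboolP.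
have [u [[Pu lbu] _]] := ord_le_wo ne.
exists u; split; first exact/asboolP.
by move=> s Ps; apply: lbu; exact/asboolP.
Qed.

Lemma ord_le_total s t : ord_le s t || ord_le t s.
Proof.
have wo : wo_chain (@ord_le a) predT by move=> A _; exact: ord_le_wo.
by apply: (wo_chainW wo).
Qed.

Lemma ord_le_refl t : ord_le t t.
Proof. by have := ord_le_total t t; rewrite orbb. Qed.

Lemma ord_le_anti s t : ord_le s t -> ord_le t s -> s = t.
Proof.
have wo : wo_chain (@ord_le a) predT by move=> A _; exact: ord_le_wo.
by move=> st ts; apply: (wo_chain_antisymmetric wo) => //; rewrite st ts.
Qed.

Lemma ord_le_trans s r t : ord_le r s -> ord_le s t -> ord_le r t.
Proof.
(* Transitivity comes from the least element of {r, s, t}: if it is [s] or [t], antisymmetry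
   identifies two of the points. *)
have [u [us lb]] := @ord_min (fun u => u = r \/ u = s \/ u = t) (ex_intro _ r (or_introl erefl)).
have ur := lb r (or_introl erefl).
have us' := lb s (or_intror (or_introl erefl)).
have ut := lb t (or_intror (or_intror erefl)).
case: us => [<- //|[eu|eu]] rs st; subst u.
- by rewrite (ord_le_anti rs ur).
- by rewrite (ord_le_anti us' st).
Qed.

Lemma ord_leNlt s t : ord_le s t = ~~ ord_lt t s.
Proof.
rewrite /ord_lt negb_and negbK; case: (altP (t =P s)) => [->|ne] /=.
  by rewrite ord_le_refl.
case: (boolP (ord_le t s)) => ts; last by have := ord_le_total s t; rewrite (negbTE ts) orbF.
by apply/negP => st; case/eqP: ne; exact: ord_le_anti.
Qed.

Lemma ord_ltNle s t : ord_lt s t = ~~ ord_le t s.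
Proof. by rewrite ord_leNlt negbK. Qed.

Lemma ord_ltW s t : ord_lt s t -> ord_le s t.
Proof. by case/andP. Qed.

Lemma ord_ltxx t : ord_lt t t = false.
Proof. by rewrite /ord_lt eqxx. Qed.

Lemma ord_lt_le_trans s r t : ord_lt r s -> ord_le s t -> ord_lt r t.
Proof.
rewrite !ord_ltNle => nsr st; apply/negP => tr.
by case/negP: nsr; exact: ord_le_trans tr.
Qed.

Lemma ord_le_lt_trans s r t : ord_le r s -> ord_lt s t -> ord_lt r t.
Proof.
rewrite !ord_ltNle => rs nts; apply/negP => tr.
by case/negP: nts; exact: ord_le_trans rs.
Qed.

Lemma ord_lt_trans s r t : ord_lt r s -> ord_lt s t -> ord_lt r t.
Proof. by move=> rs /ord_ltW; exact: ord_lt_le_trans. Qed.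

Lemma ord_le_eqVlt s t : ord_le s t -> s = t \/ ord_lt s t.
Proof. by rewrite /ord_lt; case: eqP => [|_]; [left|right]. Qed.

Lemma ord_lt_wf : well_founded (fun s t => ord_lt s t).
Proof.
move=> t; apply: contrapT => nt.
have [u [nu lb]] := ord_min (ex_intro (fun t => ~ Acc (fun s t => ord_lt s t) t) t nt).
apply: nu; constructor => s su; apply: contrapT => ns.
by have := lb s ns; rewrite ord_leNlt su.
Qed.

Lemma ord_cases t :
  [\/ ord_is_zero t, exists s, ord_is_succ s t | ord_is_limit t].
Proof.
have [z|nz] := pselect (ord_is_zero t); first exact: Or31.
have [s|ns] := pselect (exists s, ord_is_succ s t); first exact: Or32.
by apply: Or33; split => // s ss; apply: ns; exists s.
Qed.

Lemma ord_is_succ_inj r s t : ord_is_succ r t -> ord_is_succ s t -> r = s.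
Proof. by move=> [rt hr] [st hs]; apply: ord_le_anti; [exact: hs|exact: hr]. Qed.

End OrdinalTheory.

Section Runs.
Variables (e : program) (z x : cantor_space).

Lemma limsup_bit_ext (a : ordinal_type) (b b' : a -> bool) t :
  (forall s, ord_lt s t -> b s = b' s) -> limsup_bit b t = limsup_bit b' t.
Proof.
move=> bb'; apply/asboolP/asboolP => h r rt; have [s [rs st bs]] := h r rt;
  by exists s; split => //; rewrite ?bb' // -bb'.
Qed.

Lemma run_exists (a : ordinal_type) : exists c : a -> config e, is_run z x c.
Proof.
(* Values exist only below [t]; elsewhere [c] takes a junk configuration, which neither the
   successor nor the limit clause reads. *)
pose body (t : a) (rec : forall s, ord_lt s t -> config e) : config e :=
  let c s := match pselect (ord_lt s t) with
             | left h => rec s h | right _ => init_config e x end in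
  match pselect (exists s, ord_is_succ s t) with
  | left h => step z (c (sval (cid h)))
  | right _ => if `[< ord_is_zero t >] then init_config e x else limit_config c t
  end.
pose c := Fix (@ord_lt_wf a) (fun=> config e) body.
have cE t : c t = body t (fun s _ => c s).
  rewrite /c Fix_eq // => u f g fg; congr (body u _).
  by apply: functional_extensionality_dep => s; apply: functional_extensionality_dep => h; exact: fg.
exists c => t; split.
- move=> zt; rewrite cE /body; case: pselect => [h|?]; last by case: asboolP.
  by case: (h) => s [st ?]; case/negP: (zt s).
- move=> s st; rewrite cE /body; case: pselect => [h|[]]; last by exists s.
  have es := ord_is_succ_inj (svalP (cid h)) st; rewrite es.
  by congr step; case: pselect => //; case: st.
- move=> [nz ns]; rewrite cE /body; case: pselect => [[s /ns//]|?].
  case: asboolP => // _; rewrite /limit_config; congr Config;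
    by apply/funext => n; apply: limsup_bit_ext => s st; case: pselect.
Qed.

End Runs.

(* [sim s s'] says that the initial segments below [s] and [s'] are isomorphic. *)
Inductive sim (a a' : ordinal_type) (s : a) (s' : a') : Prop :=
  Sim of (forall r, ord_lt r s -> exists2 r', ord_lt r' s' & sim r r')
       & (forall r', ord_lt r' s' -> exists2 r, ord_lt r s & sim r r').

Lemma sim_sym (a a' : ordinal_type) (s : a) (s' : a') : sim s s' -> sim s' s.
Proof.
elim/(well_founded_ind (@ord_lt_wf a)): s s' => s ih s' [h h']; split.
  by move=> r' /h' [r rs rr']; exists r => //; exact: ih.
by move=> r rs; have [r' ? ?] := h r rs; exists r' => //; exact: ih.
Qed.

(** Descent: if s' < t' both matched [s], then s' would match some r < s, which also matches a point
    below s', and the situation recurs at [r]. Hence partners are unique. *)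
Lemma sim_nlt (a a' : ordinal_type) (s : a) (s' t' : a') :
  sim s s' -> sim s t' -> ~~ ord_lt s' t'.
Proof.
elim/(well_founded_ind (@ord_lt_wf a)): s s' t' => s ih s' t' [h _] [_ h'].
apply/negP => /h' [r rs rs']; have [r'' r''s' rr''] := h r rs.
by have := ih r rs _ _ rr'' rs'; rewrite r''s'.
Qed.

Lemma sim_le (a a' : ordinal_type) (s t : a) (s' t' : a') :
  sim s s' -> sim t t' -> ord_le s t -> ord_le s' t'.
Proof.
move=> [_ h] tt' st; rewrite ord_leNlt; apply/negP => /h [q qs qt'].
have := sim_nlt (sim_sym qt') (sim_sym tt').
by rewrite (ord_lt_le_trans qs st).
Qed.

Lemma sim_zero (a a' : ordinal_type) (s : a) (s' : a') :
  sim s s' -> ord_is_zero s -> ord_is_zero s'.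
Proof. by move=> [_ h] zs r'; apply/negP => /h [r rs]; have := zs r; rewrite rs. Qed.

Lemma sim_succ (a a' : ordinal_type) (s r : a) (s' : a') :
  sim s s' -> ord_is_succ r s -> exists2 r', ord_is_succ r' s' & sim r r'.
Proof.
move=> [h h'] [rs hr]; have [r' r's' rr'] := h r rs.
exists r' => //; split => // q' /h' [q qs qq'].
exact: sim_le qq' rr' (hr q qs).
Qed.

Lemma sim_limsup (a a' : ordinal_type) (s : a) (s' : a') b b' :
  sim s s' -> (forall r r', ord_lt r s -> sim r r' -> b r = b' r') ->
  limsup_bit b s -> limsup_bit b' s'.
Proof.
move=> [h h'] bb' /asboolP lb; apply/asboolP => r' /h' [r rs rr'].
have [q [rq qs bq]] := lb r rs; have [q' q's' qq'] := h q qs.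
by exists q'; split; [exact: sim_le rr' qq' rq| |rewrite -(bb' q)].
Qed.

(** Each clause of [is_run] refers only to the order up to a stage, and [sim] preserves zero,
    successors and limits, so well-founded induction applies. *)
Lemma sim_run (e : program) (z x : cantor_space) (a a' : ordinal_type)
    (c : a -> config e) (c' : a' -> config e) (s : a) (s' : a') :
  is_run z x c -> is_run z x c' -> sim s s' -> c s = c' s'.
Proof.
move=> rc rc'; elim/(well_founded_ind (@ord_lt_wf a)): s s' => s ih s' ss'.
have [c0 cS cL] := rc s; have [c'0 c'S c'L] := rc' s'.
have [zs|[r rs]|ls] := ord_cases s.
- by rewrite c0 // c'0 //; exact: sim_zero ss' zs.
- have [r' r's' rr'] := sim_succ ss' rs.
  by rewrite (cS r) // (c'S r') // (ih r _ r' rr') //; case: rs.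
- have ls' : ord_is_limit s'.
    split=> [zs'|r' rs']; first by case: ls => [nz _]; apply: nz; exact: sim_zero (sim_sym ss') zs'.
    by have [r rs _] := sim_succ (sim_sym ss') rs'; case: ls => _ /(_ r).
  have E r r' : ord_lt r s -> sim r r' -> c r = c' r' by move=> rs; exact: ih.
  (* Here only the partner is known to lie below s'; that r < s follows from uniqueness of
     partners. *)
  have E' r' r : ord_lt r' s' -> sim r' r -> c r = c' r'.
    move=> r's' r'r; apply: E (sim_sym r'r); case: (ss') => _ /(_ r' r's') [q qs qr'].
    apply: ord_le_lt_trans qs; rewrite ord_leNlt.
    exact: sim_nlt (sim_sym qr') r'r.
  rewrite cL // c'L // /limit_config; congr Config; apply/funext => n; apply/idP/idP.
  all: by [apply: (sim_limsup ss') => r r' rs /(E r r' rs) ->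
          |apply: (sim_limsup (sim_sym ss')) => r' r rs /(E' r' r rs) ->].
Qed.

(** Comparability of well-orders. Otherwise, let [u] be the least point without partner up to t',
    and [w] the least point without partner below [u]; then [u] and [w] match each other. *)
Lemma sim_total (a a' : ordinal_type) (t : a) (t' : a') :
  (exists2 s', ord_le s' t' & sim t s') \/ (exists2 s, ord_lt s t & sim s t').
Proof.
have [|nt] := pselect (exists2 s', ord_le s' t' & sim t s'); [by left|right].
have [u [nu ulb]] := ord_min (ex_intro (fun s => ~ exists2 s', ord_le s' t' & sim s s') t nt).
have [[r ru rt']|nt'] := pselect (exists2 r, ord_lt r u & sim r t').
  by exists r => //; apply: ord_lt_le_trans ru _; exact: ulb.
have [w [nw wlb]] := ord_min (ex_intro (fun r' => ~ exists2 r, ord_lt r u & sim r r') t' nt').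
case: nu; exists w; first exact: wlb.
split=> [r ru|r' r'w].
  have [[r' r't' rr']|nr] := pselect (exists2 s', ord_le s' t' & sim r s'); last first.
    by have := ulb r nr; rewrite ord_leNlt ru.
  exists r' => //; rewrite ord_ltNle; apply/negP => /ord_le_eqVlt [ew|wr'].
    by apply: nw; exists r => //; rewrite ew.
  case: rr' => _ /(_ w wr') [q qr qw]; apply: nw; exists q => //.
  exact: ord_lt_trans qr ru.
by apply: contrapT => nr; have := wlb r' nr; rewrite ord_leNlt r'w.
Qed.

(** This links the halting stage bounded in one ordinal with the output computed in another. *)
Lemma halts_at_inj (e : program) (z x : cantor_space) (a a' : ordinal_type)
    (t : a) (t' : a') (y y' : cantor_space) :
  halts_at e z x t y -> halts_at e z x t' y' -> y = y'.
Proof.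
move=> [c [rc ct nc <-]] [c' [rc' ct' nc' <-]].
have [[s' s't' ts']|[s st st']] := sim_total t t'.
  have E := sim_run rc rc' ts'; case/ord_le_eqVlt: s't' => [<-|/nc'].
    by rewrite E.
  by rewrite -E.
by case: (nc s st); rewrite (sim_run rc rc' st').
Qed.

(** * Ordinal sums and products *)

Section LexSum.
Variables (I : ordinal_type) (X : I -> ordinal_type).
Local Notation sumT := {i : I & X i}.

Definition lex_le : rel sumT := fun u v =>
  ord_lt (tag u) (tag v) ||
  ((tag u == tag v) && ord_le (tagged u) (tagged_as u v)).

Lemma lex_le_wo : well_order lex_le.
Proof.
apply: antisymmetric_well_order.
  move=> [i p] [j q] /=; rewrite /lex_le /=; case: (altP (i =P j)) => [e|ne].
    subst j; rewrite !tagged_asE eqxx ord_ltxx /= => /andP [pq qp].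
    by rewrite (ord_le_anti pq qp).
  rewrite /= orbF eq_sym (negbTE ne) /= orbF => /andP [ij ji].
  by move: (ord_lt_trans ij ji); rewrite ord_ltxx.
move=> A [u Au].
have [i [[v [Av vi]] ilb]] := @ord_min I (fun i => exists v, v \in A /\ tag v = i)
  (ex_intro _ (tag u) (ex_intro _ u (conj Au erefl))).
case: v Av vi => j q /= Aq ji; subst j.
have [p [Ap plb]] := @ord_min (X i) (fun p => Tagged X p \in A) (ex_intro _ q Aq).
exists (Tagged X p); split => // -[j r] Ar; rewrite /lex_le /=.
have ij := ilb j (ex_intro _ _ (conj Ar erefl)).
rewrite /ord_lt ij andbT; case: (altP (i =P j)) => //= e; subst j.
by rewrite tagged_asE plb.
Qed.

Definition lex_sum := OrdinalType lex_le_wo.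

Lemma lex_sum_lt i j (p : X i) (q : X j) :
  ord_lt i j -> ord_lt (Tagged X p : lex_sum) (Tagged X q : lex_sum).
Proof.
move=> ij; rewrite /ord_lt /= /lex_le /= ij andbT; apply/eqP => /(congr1 tag) /= e.
by move: ij; rewrite e ord_ltxx.
Qed.

Lemma lex_sum_lt_fiber i (p q : X i) :
  ord_lt (Tagged X p : lex_sum) (Tagged X q : lex_sum) = ord_lt p q.
Proof.
by rewrite /ord_lt /= eq_Tagged /= /lex_le /= tagged_asE eqxx ord_ltxx.
Qed.

Lemma lex_sum_ltP (u v : lex_sum) : ord_lt u v ->
  ord_lt (tag u) (tag v) \/ (tag u == tag v) && ord_lt (tagged u) (tagged_as u v).
Proof.
case: u v => [i p] [j q]; rewrite /ord_lt /= /lex_le /= => /andP [ne] /orP[|/andP [/eqP e]].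
  by left.
subst j; rewrite tagged_asE => pq; right; rewrite eqxx /= pq andbT.
by apply: contra ne => /eqP ->.
Qed.

Lemma lex_sum_countable : countable_ordinal I ->
  (forall i, countable_ordinal (X i)) -> countable_ordinal lex_sum.
Proof.
move=> cI cX; rewrite /countable_ordinal.
have -> : [set: lex_sum] = \bigcup_(i in [set: I]) ((fun p : X i => Tagged X p : lex_sum) @` [set: X i]).
  by apply/seteqP; split => // -[i p] _; exists i => //; exists p.
by apply: bigcup_countable => // i _; apply: sub_countable (card_image_le _ _) (cX i).
Qed.

End LexSum.

Lemma leq_wo : well_order leq.
Proof.
apply: antisymmetric_well_order; first exact: anti_leq.
move=> A [n An]; have ex : exists n, n \in A by exists n.
by exists (ex_minn ex); case: ex_minnP => m Am lb; split.
Qed.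

Definition ord_omega := OrdinalType leq_wo.

Lemma omega_ltE (m n : ord_omega) : ord_lt m n = (m < n)%N.
Proof. by rewrite /ord_lt ltn_neqAle. Qed.

Lemma countable_omega : countable_ordinal ord_omega.
Proof. exact: countableP. Qed.

(** The order type omega + 1, with [None] on top: it will index the subtrees of a node followed by
    the node itself. *)
Definition succ_omega_le : rel (option nat) := fun u v =>
  if v is Some n then if u is Some m then m <= n else false else true.

Lemma succ_omega_le_wo : well_order succ_omega_le.
Proof.
apply: antisymmetric_well_order.
  by move=> [m|] [n|] //= /anti_leq ->.
move=> A [u Au]; have [[n An]|h] := pselect (exists n, Some n \in A).
  have ex : exists n, Some n \in A by exists n.
  by exists (Some (ex_minn ex)); case: ex_minnP => m Am lb; split => // -[k /lb|].
by exists u; split => //; case: u Au => [n An|_]; [case: h; exists n|move=> [n|//] An; case: h; exists n].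
Qed.

Definition succ_omega := OrdinalType succ_omega_le_wo.

Lemma unit_le_wo : well_order (fun _ _ : unit => true).
Proof. by move=> A [[] Au]; exists tt; split=> // -[]. Qed.

Definition ord_one := OrdinalType unit_le_wo.

Section TimesOmega.
Variable B : ordinal_type.

(** The product with one copy of omega for each point of [B]. It is used twice: to number the steps
    within sweeps, and to number the sweeps themselves. *)
Definition times_omega := lex_sum (fun _ : B => ord_omega).

Definition tick (b : B) (n : nat) : times_omega := existT (fun _ : B => ord_omega) b n.

Lemma tickP (t : times_omega) : exists b n, t = tick b n.
Proof. by case: t => b n; exists b, n. Qed.

Lemma tick_ltE b b' m n :
  ord_lt (tick b m) (tick b' n) = ord_lt b b' || ((b == b') && (m < n)).
Proof.
apply/idP/idP => [/lex_sum_ltP/= [->//|]|/orP [|/andP [/eqP <- mn]]].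
- case/andP=> /eqP e; subst b'; rewrite tagged_asE omega_ltE eqxx => ->.
  by rewrite orbT.
- exact: lex_sum_lt.
- by rewrite lex_sum_lt_fiber omega_ltE.
Qed.

Lemma tick_succ b n : ord_is_succ (tick b n) (tick b n.+1).
Proof.
split; first by rewrite tick_ltE eqxx leqnn orbT.
move=> r; have [b' [m ->]] := tickP r; rewrite ord_leNlt !tick_ltE ltnS => h.
apply/negP => /orP [bb'|/andP [/eqP e nm]]; case/orP: h => [b'b|/andP [/eqP e' mn]].
- by have := ord_lt_trans bb' b'b; rewrite ord_ltxx.
- by rewrite e' ord_ltxx in bb'.
- by rewrite e ord_ltxx in b'b.
- by rewrite ltnNge mn in nm.
Qed.

Lemma tick_zero b : ord_is_zero b -> ord_is_zero (tick b 0).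
Proof.
move=> zb r; have [b' [m ->]] := tickP r.
by rewrite tick_ltE ltn0 andbF orbF; exact: zb.
Qed.

Lemma tick_limit b : ~ ord_is_zero b -> ord_is_limit (tick b 0).
Proof.
move=> nz; split=> [z|s [st h]].
  apply: nz => b'; have := z (tick b' 0); rewrite tick_ltE ltnn andbF orbF.
  exact.
have [b' [m es]] := tickP s; subst s; move: st; rewrite tick_ltE ltn0 andbF orbF => b'b.
have lt1 : ord_lt (tick b' m.+1) (tick b 0) by rewrite tick_ltE b'b.
by have := h _ lt1; rewrite ord_leNlt tick_ltE eqxx leqnn orbT.
Qed.

Lemma times_omega_countable : countable_ordinal B -> countable_ordinal times_omega.
Proof. by move=> cB; apply: lex_sum_countable => // _; exact: countable_omega. Qed.

End TimesOmega.

(** * Runs of countable length are Borel *)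

(** Counterexamples agreeing with [x] on longer and longer prefixes would converge to [x] in the
    product topology, hence enter [U]. *)
Lemma open_cylinder (U : set cantor_space) (x : cantor_space) : open U -> U x ->
  exists n, forall y : cantor_space, (forall i, i < n -> y i = x i) -> U y.
Proof.
move=> oU Ux; apply: contrapT => nex.
have /choice [u uP] n : exists y : cantor_space, (forall i, i < n -> y i = x i) /\ ~ U y.
  apply: contrapT => h; apply: nex; exists n => y yx; apply: contrapT => nU.
  by apply: h; exists y.
suff ux : u @ \oo --> x.
  have [n _ h] : \forall n \near \oo, U (u n) by apply: ux; exact: open_nbhs_nbhs.
  by case: (uP n) => _; apply; apply: h => /=.
apply/cvg_sup => i A /=; rewrite (@nbhsE (initial_topology (fun f : nat -> bool => f i))) => -[B [[C oC CB] Bx] BA].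
exists i.+1 => // n /= ni; apply: BA; rewrite -CB /=.
by rewrite (uP n).1 //; move: Bx; rewrite -CB.
Qed.

Lemma borelC (A : set cantor_space) : borel_set A -> borel_set (~` A).
Proof. exact: (@measurableC _ borel_cantor). Qed.

Lemma borel_exists (I : Type) (P : I -> set cantor_space) : countable [set: I] ->
  (forall i, borel_set (P i)) -> borel_set [set x | exists i, P i x].
Proof.
move=> cI bP; have := @countable_bigcupT_measurable _ borel_cantor _ P cI bP.
by congr (measurable _); apply/seteqP; split => x [i]; [move=> _ ?|move=> ?]; exists i.
Qed.

Lemma borel_forall (I : Type) (P : I -> set cantor_space) : countable [set: I] ->
  (forall i, borel_set (P i)) -> borel_set [set x | forall i, P i x].
Proof.
move=> cI bP; have -> : [set x | forall i, P i x] = ~` [set x | exists i, (~` P i) x].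
  apply/seteqP; split => x /= h; first by move=> [i]; apply.
  by move=> i; apply: contrapT => np; apply: h; exists i.
by apply: borelC; apply: (borel_exists cI) => i; exact: borelC.
Qed.

Lemma borelI (A B : set cantor_space) :
  borel_set A -> borel_set B -> borel_set [set x | A x /\ B x].
Proof. exact: (@measurableI _ borel_cantor). Qed.

Lemma borelT (P : Prop) : borel_set [set x | P].
Proof.
have [p|np] := pselect P.
  have -> : [set _ | P] = [set: cantor_space] by apply/seteqP; split.
  exact: (@measurableT _ borel_cantor).
have -> : [set _ | P] = set0 :> set cantor_space by apply/seteqP; split.
exact: (@measurable0 _ borel_cantor).
Qed.

Lemma borel_imp (P : Prop) (A : set cantor_space) :
  borel_set A -> borel_set [set x | P -> A x].
Proof.
move=> bA; have [p|np] := pselect P.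
  suff -> : [set x | P -> A x] = A by [].
  by apply/seteqP; split => x //=; apply.
have -> : [set x | P -> A x] = [set x | True].
  by apply/seteqP; split => x /= h; [exact: I|move=> /np].
exact: borelT.
Qed.

Lemma open_coord i (b : bool) : open [set x : cantor_space | x i = b].
Proof.
have cont : continuous (fun x : cantor_space => x i) by exact: (@proj_continuous nat (fun=> bool) i).
exact: (continuousP _).1 cont [set b] (discrete_open _).
Qed.

Lemma borel_coord i : borel_set [set x : cantor_space | x i].
Proof. by apply: sub_sigma_algebra; exact: open_coord. Qed.

Section Discrete.
Implicit Types T U : Type.

(* Measurability into a discrete space. *)
Definition borel_map T (phi : cantor_space -> T) :=
  forall S : set T, borel_set (phi @^-1` S).

Lemma borel_map_cst T (v : T) : borel_map (fun=> v).
Proof. by move=> S; exact: borelT. Qed.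

(** Split along the countably many values of [phi]. This handles cells whose index depends on the
    input, such as the one under the head. *)
Lemma borel_map_bind T U (phi : cantor_space -> T) (psi : T -> cantor_space -> U) :
  countable [set: T] -> borel_map phi -> (forall v, borel_map (psi v)) ->
  borel_map (fun x => psi (phi x) x).
Proof.
move=> cT bphi bpsi S.
have -> : (fun x => psi (phi x) x) @^-1` S =
    [set x | exists v, phi x = v /\ S (psi v x)].
  by apply/seteqP; split => x /= => [h|[v [<-]]//]; exists (phi x).
apply: borel_exists => // v; apply: borelI; first exact: (bphi [set v]).
exact: (bpsi v S).
Qed.

Lemma borel_map_comp T U (g : T -> U) (phi : cantor_space -> T) :
  borel_map phi -> borel_map (g \o phi).
Proof. by move=> bphi S; exact: (bphi (g @^-1` S)). Qed.

Lemma borel_map_bool (phi : cantor_space -> bool) :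
  borel_set [set x | phi x] -> borel_map phi.
Proof.
move=> b S.
have -> : phi @^-1` S = [set x | forall v : bool, ~ (phi x = v /\ ~ S v)].
  apply/seteqP; split => x /= h; first by move=> v [<-]; apply.
  by apply: contrapT => nS; apply: (h (phi x)).
apply: borel_forall => [|v]; first exact: countableP.
apply: borelC; apply: borelI; last exact: borelT.
case: v => //; have -> : (fun x => phi x = false) = ~` [set x | phi x].
  by apply/seteqP; split => x /=; [move=> ->|move/negP/negbTE].
exact: borelC.
Qed.

Lemma borel_map_ite (b : bool) T (phi psi : cantor_space -> T) :
  borel_map phi -> borel_map psi -> borel_map (fun x => if b then phi x else psi x).
Proof. by case: b. Qed.

End Discrete.

(** An open set is the union of the countably many cylinders inside it, and a cylinder constrains
    finitely many coordinates. *)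
Lemma borel_fun_coord (f : cantor_space -> cantor_space) :
  (forall n, borel_set [set x | f x n]) -> borel_fun f.
Proof.
move=> bf; apply: (@measurability _ _ borel_cantor borel_cantor _ _ (@open cantor_space)) => //.
move=> _ [U oU <-]; rewrite setTI.
pose cyl (s : seq bool) : set cantor_space := [set y | forall i, i < size s -> y i = nth false s i].
have -> : f @^-1` U = [set x | exists s, cyl s `<=` U /\ cyl s (f x)].
  apply/seteqP; split => x /=; last by move=> [s [sU /sU]].
  move=> Uf; have [n hn] := open_cylinder oU Uf; exists (mkseq (f x) n).
  split=> [y|i]; rewrite /cyl /= size_mkseq => h; last by rewrite nth_mkseq.
  by apply: hn => i ilt; rewrite h // nth_mkseq.
apply: borel_exists => [|s]; first exact: countableP.
apply: borelI; first exact: borelT.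
apply: borel_forall => [|i]; first exact: countableP.
apply: borel_imp.
exact: (borel_map_bool (bf i) [set nth false s i]).
Qed.

Lemma borel_fun_borel (f : cantor_space -> cantor_space) n :
  borel_fun f -> borel_set [set x | f x n].
Proof.
move=> bf; have := bf measurableT [set y | y n] (borel_coord n).
by rewrite setTI.
Qed.

Lemma borel_char_fun (A : set cantor_space) : borel_set A <-> borel_fun (char_fun A).
Proof.
split=> [bA|/(borel_fun_borel 0)]; last first.
  by congr borel_set; apply/seteqP; split => x /asboolP.
apply: borel_fun_coord => n; case: n => [|n].
  suff -> : [set x | char_fun A x 0] = A by [].
  by apply/seteqP; split => x /asboolP.
have -> : [set x | char_fun A x n.+1] = [set x | False] by apply/seteqP; split.
exact: borelT.
Qed.

Section RunBorel.
Variables (e : program) (z : cantor_space) (a : ordinal_type).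
Hypothesis a_countable : countable_ordinal a.
Variable c : cantor_space -> a -> config e.
Hypothesis run_c : forall x, is_run z x (c x).

(** [borel_map] tests arbitrary subsets of the target, which is too much to ask of a whole tape;
    hence one condition per cell. *)
Definition borel_config (t : a) :=
  [/\ borel_map (fun x => cstate (c x t)), borel_map (fun x => chead (c x t)),
      forall n, borel_map (fun x => cinput (c x t) n),
      forall n, borel_map (fun x => cwork (c x t) n) &
      forall n, borel_map (fun x => coutput (c x t) n)].

Lemma borel_limsup (b : cantor_space -> a -> bool) (t : a) :
  (forall s, ord_lt s t -> borel_map (fun x => b x s)) ->
  borel_map (fun x => limsup_bit (b x) t).
Proof.
move=> bb; apply: borel_map_bool.
have -> : [set x | limsup_bit (b x) t] =
    [set x | forall r, ord_lt r t -> exists s, (ord_le r s /\ ord_lt s t) /\ b x s].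
  apply/seteqP; split => x /= => [/asboolP h|h]; last apply/asboolP.
    by move=> r /h [s [? ? ?]]; exists s.
  by move=> r /h [s [[? ?] ?]]; exists s.
apply: borel_forall => // i; apply: borel_imp; apply: borel_exists => // s.
have [st|nst] := pselect (ord_lt s t).
  apply: borelI; first exact: borelT.
  exact: (bb s st [set true]).
have -> : (fun x => (ord_le i s /\ ord_lt s t) /\ b x s) = [set x | False].
  by apply/seteqP; split => x //= -[[]].
exact: borelT.
Qed.

Lemma borel_runs (t : a) : borel_config t.
Proof.
elim/(well_founded_ind (@ord_lt_wf a)): t => t ih.
have [zt|[s st]|lt] := ord_cases t.
- have E x : c x t = init_config e x by case: (run_c x t) => ->.
  split; move=> *; under eq_fun do rewrite E /=; try exact: borel_map_cst.
  by apply: borel_map_bool; exact: borel_coord.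
- have E x : c x t = step z (c x s) by case: (run_c x t) => _ /(_ s st).
  have [bq bi bin bw bo] := ih s (proj1 st).
  (* [key] has countable range and determines the instruction and the cell it acts on. The head
     position must be bound before the three bits read there. *)
  pose key x := (cstate (c x s), chead (c x s), cinput (c x s) (chead (c x s)),
    cwork (c x s) (chead (c x s)), coutput (c x s) (chead (c x s))).
  have bkey : borel_map key.
    apply: (@borel_map_bind _ _ _ (fun q x => (q, chead (c x s), cinput (c x s) (chead (c x s)),
      cwork (c x s) (chead (c x s)), coutput (c x s) (chead (c x s)))) _ bq) => [|q]; first exact: countableP.
    apply: (@borel_map_bind _ _ _ (fun i x => (q, i, cinput (c x s) i,
      cwork (c x s) i, coutput (c x s) i)) _ bi) => [|i]; first exact: countableP.
    apply: (@borel_map_bind _ _ _ (fun b x => (q, i, b,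
      cwork (c x s) i, coutput (c x s) i)) _ (bin i)) => [|b]; first exact: countableP.
    apply: (@borel_map_bind _ _ _ (fun b' x => (q, i, b, b', coutput (c x s) i)) _ (bw i)) => [|b']; first exact: countableP.
    exact: (borel_map_comp (fun b'' => (q, i, b, b', b'')) (bo i)).
  pose d (k : pstate e * nat * bool * bool * bool) :=
    let: (q, i, b1, b2, b3) := k in delta q (b1, b2, b3, z i).
  have E' x : c x t = Config (d (key x)).1.1 (move_head (d (key x)).2 (chead (c x s)))
     (write (cinput (c x s)) (key x).1.1.1.2 (d (key x)).1.2.1.1)
     (write (cwork (c x s)) (key x).1.1.1.2 (d (key x)).1.2.1.2)
     (write (coutput (c x s)) (key x).1.1.1.2 (d (key x)).1.2.2).
    by rewrite E /step /d /=; case: delta => [[q [[b1 b2] b3]] m].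
  split; [| |move=> n..]; under eq_fun do rewrite E' /=.
  + exact: (borel_map_comp (fun k => (d k).1.1) bkey).
  + exact: (borel_map_comp (fun k => move_head (d k).2 k.1.1.1.2) bkey).
  + apply: (@borel_map_bind _ _ _ (fun k x => write (cinput (c x s)) k.1.1.1.2 (d k).1.2.1.1 n) _ bkey) => [|k]; first exact: countableP.
    by apply: borel_map_ite => //; exact: borel_map_cst.
  + apply: (@borel_map_bind _ _ _ (fun k x => write (cwork (c x s)) k.1.1.1.2 (d k).1.2.1.2 n) _ bkey) => [|k]; first exact: countableP.
    by apply: borel_map_ite => //; exact: borel_map_cst.
  + apply: (@borel_map_bind _ _ _ (fun k x => write (coutput (c x s)) k.1.1.1.2 (d k).1.2.2 n) _ bkey) => [|k]; first exact: countableP.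
    by apply: borel_map_ite => //; exact: borel_map_cst.
- have E x : c x t = limit_config (c x) t by case: (run_c x t) => _ _ ->.
  split; [| |move=> n..]; under eq_fun do rewrite E /=; try exact: borel_map_cst.
  all: by apply: borel_limsup => s /ih [].
Qed.

End RunBorel.

Lemma borel_fun_of_program (f : cantor_space -> cantor_space) (e : program)
    (z : cantor_space) (a : ordinal_type) :
  countable_ordinal a -> computes e z f ->
  (forall x, halts_before e z x a) -> borel_fun f.
Proof.
move=> ca cf hb.
have /choice [c cP] x : exists c : a -> config e, exists t, [/\ is_run z x c,
    cstate (c t) = halt e, forall s, ord_lt s t -> cstate (c s) <> halt e &
    coutput (c t) = f x].
  have [t [y ht]] := hb x; have [a' [t' ht']] := cf x.
  by move: ht (halts_at_inj ht ht') => [c [? ? ? <-]] yf; exists c, t.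
have br := borel_runs ca (fun x => let: ex_intro _ (And4 r _ _ _) := cP x in r).
apply: borel_fun_coord => n.
(* The halting stage depends on [x], but ranges over the countable [a], so a countable union removes
   it. *)
have -> : [set x | f x n] = [set x | exists t, (cstate (c x t) = halt e /\
    forall s, ord_lt s t -> ~ (cstate (c x s) = halt e)) /\ coutput (c x t) n].
  apply/seteqP; split => x /=; have [t [_ ct nt ft]] := cP x.
    by move=> fn; exists t; rewrite ft.
  move=> [t' [[ct' nt'] ot']]; rewrite -ft.
  suff -> : t = t' by [].
  apply: ord_le_anti; rewrite ord_leNlt; apply/negP.
    by move=> /nt.
  by move=> /nt'.
apply: borel_exists => // t; have [bs _ _ _ bo] := br t.
apply: borelI; last exact: (bo n [set true]).
apply: borelI; first exact: (bs [set halt e]).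
apply: borel_forall => // s; apply: borel_imp; apply: borelC.
by case: (br s) => /(_ [set halt e]).
Qed.

(** * Machines working on blocks of cells *)

Section Leads.
Variables (e : program) (z : cantor_space).

(** At least one step is taken, so that long computations exhaust omega. The last configuration is
    exempt from [P]; the next segment accounts for it. *)
Definition leads (P : config e -> Prop) (c c' : config e) :=
  exists n, iter n.+1 (step z) c = c' /\
    forall k, k <= n -> P (iter k (step z) c).

Lemma leads_trans (P : config e -> Prop) c1 c2 c3 :
  leads P c1 c2 -> leads P c2 c3 -> leads P c1 c3.
Proof.
move=> [n [<- h]] [n' [<- h']]; exists (n' + n.+1)%N.
split; first by rewrite -iterD addSn.
move=> k kn; case: (leqP k n) => [|nk]; first exact: h.
have -> : k = (k - n.+1 + n.+1)%N by lia.
by rewrite iterD; apply: h'; lia.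
Qed.

Lemma leads_weak (P P' : config e -> Prop) c c' :
  (forall d, P d -> P' d) -> leads P c c' -> leads P' c c'.
Proof. by move=> PP [n [? h]]; exists n; split => // k /h /PP. Qed.

Lemma leads_iter (P : config e -> Prop) (f : nat -> config e) n :
  (forall k, k <= n -> P (f k) /\ step z (f k) = f k.+1) ->
  leads P (f 0) (f n.+1).
Proof.
move=> h; have E k : k <= n.+1 -> iter k (step z) (f 0) = f k.
  by elim: k => //= k ih kn; rewrite ih; [case: (h k kn)|exact: ltnW].
exists n; split; first exact: E.
by move=> k kn; rewrite E; [case: (h k kn)|exact: leqW].
Qed.

End Leads.

Lemma write_id (u : cantor_space) i : write u i (u i) = u.
Proof. by apply/funext => j; rewrite /write; case: eqP => [->|]. Qed.

(* Cells are grouped into blocks of [w.+1]; a program reads a whole block from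
   left to right, rewrites it from right to left, and then moves to a
   neighbouring block. *)
Section Blocks.
Variables (w : nat) (Q : finType).

Definition block_view := {ffun 'I_w.+1 -> bool * bool * bool * bool}.
Definition update := {ffun 'I_w.+1 -> bool * bool}.
Definition direction := option bool.

Variable init : bool -> Q.
Variable bdelta : Q -> block_view -> Q * update * direction.

Definition dir_move (d : direction) :=
  match d with None => Stay | Some false => MoveLeft | Some true => MoveRight end.

(** [BRead] collects the block and [BWrite] carries the pending update. [BShift] counts down w.+1
    single moves, hence the index in ['I_w.+2]. *)
Inductive bstate :=
  | BStart | BLimit | BHalt
  | BRead of Q & 'I_w.+1 & block_view
  | BWrite of Q & 'I_w.+1 & update & direction
  | BShift of Q & 'I_w.+2 & direction.

Definition bstate_encode (s : bstate) :
    option (option (option (Q * 'I_w.+1 * block_view +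
      Q * 'I_w.+1 * update * direction + Q * 'I_w.+2 * direction))) :=
  match s with
  | BStart => None
  | BLimit => Some None
  | BHalt => Some (Some None)
  | BRead q o b => Some (Some (Some (inl (inl (q, o, b)))))
  | BWrite q o u d => Some (Some (Some (inl (inr (q, o, u, d)))))
  | BShift q k d => Some (Some (Some (inr (q, k, d))))
  end.

Definition bstate_decode s : bstate :=
  match s with
  | None => BStart
  | Some None => BLimit
  | Some (Some None) => BHalt
  | Some (Some (Some (inl (inl (q, o, b))))) => BRead q o b
  | Some (Some (Some (inl (inr (q, o, u, d))))) => BWrite q o u d
  | Some (Some (Some (inr (q, k, d)))) => BShift q k d
  end.

Lemma bstate_codeK : cancel bstate_encode bstate_decode.
Proof. by case. Qed.

HB.instance Definition _ := Finite.copy bstate (can_type bstate_codeK).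

Definition blank : block_view := [ffun=> (false, false, false, false)].

(** At a limit the program decides on work cell 0 alone: 1 starts afresh from [init true], 0
    halts. *)
Definition block_delta (s : bstate) (b : bool * bool * bool * bool) :
    bstate * (bool * bool * bool) * move :=
  let: (bi, bw, bo, bz) := b in
  match s with
  | BStart => (BRead (init false) ord0 blank, (bi, bw, bo), Stay)
  | BLimit => (if bw then BRead (init true) ord0 blank else BHalt,
               (bi, bw, bo), Stay)
  | BHalt => (BHalt, (bi, bw, bo), Stay)
  | BRead q o buf =>
      let buf' : block_view := [ffun o' => if o' == o then b else buf o'] in
      if o == ord_max then
        let: (q', u, d) := bdelta q buf' in
        (BWrite q' ord_max u d, (bi, bw, bo), Stay)
      else (BRead q (inord o.+1) buf', (bi, bw, bo), MoveRight)
  | BWrite q o u d =>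
      if o == ord0 then (BShift q ord_max d, (bi, (u o).1, (u o).2), Stay)
      else (BWrite q (inord o.-1) u d, (bi, (u o).1, (u o).2), MoveLeft)
  | BShift q k d =>
      if k == ord0 then (BRead q ord0 blank, (bi, bw, bo), Stay)
      else (BShift q (inord k.-1) d, (bi, bw, bo), dir_move d)
  end.

Lemma block_special_uniq : uniq [:: BStart; BLimit; BHalt].
Proof. by []. Qed.

Definition block_program := Program block_special_uniq block_delta.

Variables (z x : cantor_space).

Definition at_block (q : Q) (p : nat) (W O : cantor_space) : config block_program :=
  @Config block_program (BRead q ord0 blank) (w.+1 * p) x W O.

Definition block_content (p : nat) (W O : cantor_space) : block_view :=
  [ffun o : 'I_w.+1 => let i := (w.+1 * p + o)%N in (x i, W i, O i, z i)].

Definition update_tape (p : nat) (u : 'I_w.+1 -> bool) (W : cantor_space) : cantor_space :=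
  fun j => if j %/ w.+1 == p then u (inord (j %% w.+1)) else W j.

(** Halfway through an update each cell already has its old or its new value; a later lim sup
    depends on exactly this. *)
Definition between (W O W' O' : cantor_space) (c : config block_program) :=
  [/\ cstate c <> BHalt, cinput c = x,
      forall j, cwork c j = W j \/ cwork c j = W' j &
      forall j, coutput c j = O j \/ coutput c j = O' j].

Lemma divn_block p j k : k <= w ->
  (j == w.+1 * p + k)%N = (j %/ w.+1 == p) && (j %% w.+1 == k).
Proof.
move=> kw; apply/eqP/andP => [->|[/eqP <- /eqP <-]].
  by rewrite mulnC divnMDl // modnMDl divn_small // modn_small // addn0 !eqxx.
by rewrite mulnC -divn_eq.
Qed.

Lemma read_phase q p W O :
  let: (q', u, d) := bdelta q (block_content p W O) in
  leads z (between W O W O) (at_block q p W O)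
    (@Config block_program (BWrite q' ord_max u d) (w.+1 * p + w) x W O).
Proof.
case E: bdelta => [[q' u] d].
pose buf k : block_view := [ffun o : 'I_w.+1 => if o < k then block_content p W O o
  else (false, false, false, false)].
pose f k := if k <= w then @Config block_program (BRead q (inord k) (buf k)) (w.+1 * p + k) x W O
  else @Config block_program (BWrite q' ord_max u d) (w.+1 * p + w) x W O.
have -> : at_block q p W O = f 0.
  rewrite /f /at_block leq0n addn0; congr (@Config block_program (BRead _ _ _)).
    by apply/val_inj; rewrite /= inordK.
have -> : @Config block_program (BWrite q' ord_max u d) (w.+1 * p + w) x W O = f w.+1.
  by rewrite /f ltnn.
apply: leads_iter => k kw; split.
  by rewrite /f kw; split => // j; left.
have bufS : [ffun o' => if o' == inord k then
     (x (w.+1 * p + k)%N, W (w.+1 * p + k)%N, O (w.+1 * p + k)%N, z (w.+1 * p + k)%N) else buf k o'] = buf k.+1.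
  apply/ffunP => o; rewrite !ffunE -val_eqE /= inordK // ltnS [(o <= k)%N]leq_eqVlt.
  by case: eqP => [->|].
rewrite /f kw /step /= bufS; case: ifP => [/eqP/(congr1 val)|/negbT].
  rewrite /= inordK // => ek; subst k; rewrite ltnn.
  have -> : buf w.+1 = block_content p W O.
    by apply/ffunP => o; rewrite !ffunE ltn_ord.
  by rewrite E /= !write_id.
rewrite -val_eqE /= inordK // => kw'.
have -> : k < w by rewrite ltn_neqAle kw'.
by rewrite /= !write_id addnS.
Qed.

Lemma write_phase q p (u : update) d W O :
  let W' := update_tape p (fun o => (u o).1) W in
  let O' := update_tape p (fun o => (u o).2) O in
  leads z (between W O W' O')
    (@Config block_program (BWrite q ord_max u d) (w.+1 * p + w) x W O)
    (@Config block_program (BShift q ord_max d) (w.+1 * p) x W' O').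
Proof.
move=> W' O'.
(* Writing proceeds from right to left: in [T k] the last [k] cells of the block are new. *)
pose T k (U U' : cantor_space) : cantor_space :=
  fun j => if (j %/ w.+1 == p) && (w - k < j %% w.+1) then U' j else U j.
pose f k := if k <= w then
    @Config block_program (BWrite q (inord (w - k)) u d) (w.+1 * p + (w - k)) x (T k W W') (T k O O')
  else @Config block_program (BShift q ord_max d) (w.+1 * p) x W' O'.
have T0 U U' : T 0 U U' = U.
  apply/funext => j; rewrite /T subn0 ltnNge -ltnS ltn_pmod // andbF //.
have -> : @Config block_program (BWrite q ord_max u d) (w.+1 * p + w) x W O = f 0.
  rewrite /f leq0n !T0 subn0; congr (@Config block_program (BWrite _ _ _ _)).
  by apply/val_inj; rewrite /= inordK.
have -> : @Config block_program (BShift q ord_max d) (w.+1 * p) x W' O' = f w.+1.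
  by rewrite /f ltnn.
apply: leads_iter => k kw; split.
  by rewrite /f kw; split => //= j; rewrite /T; case: ifP; auto.
have wr (g : 'I_w.+1 -> bool) U : write (T k U (update_tape p g U)) (w.+1 * p + (w - k)) (g (inord (w - k)))
    = if k < w then T k.+1 U (update_tape p g U) else update_tape p g U.
  apply/funext => j; rewrite /write divn_block ?leq_subr //.
  have -> : (if k < w then T k.+1 U (update_tape p g U) else update_tape p g U) j =
    if (j %/ w.+1 == p) && (w - k <= j %% w.+1) then update_tape p g U j else U j.
    case: ifP => kw'; rewrite /T.
      by have -> : (w - k.+1 < j %% w.+1) = (w - k <= j %% w.+1) by lia.
    have -> : (w - k)%N = 0 by lia.
    by rewrite leq0n andbT /update_tape; case: ifP.
  rewrite /T [(w - k <= _)%N]leq_eqVlt [(w - k)%N == _]eq_sym /update_tape.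
  by case: eqP => //= _; case: eqP => //= ->.
rewrite /f kw /step /=; case: ifP => [/eqP/(congr1 val)|/negbT].
  rewrite /= inordK ?ltnS ?leq_subr // => ek; rewrite /= (wr (fun o => (u o).1)) (wr (fun o => (u o).2)).
  have -> : (k < w) = false by lia.
  by rewrite write_id ek addn0.
rewrite -val_eqE /= inordK ?ltnS ?leq_subr // => kw'; rewrite /= (wr (fun o => (u o).1)) (wr (fun o => (u o).2)).
have -> : k < w by lia.
rewrite write_id; congr (@Config block_program (BWrite _ (inord _) _ _)); lia.
Qed.

Lemma shift_phase q p d W O :
  leads z (between W O W O)
    (@Config block_program (BShift q ord_max d) (w.+1 * p) x W O)
    (at_block q (move_head (dir_move d) p) W O).
Proof.
(* Subtraction is truncated: moving left from block 0 leaves the head on cell 0, in accordance with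
   [move_head] on block numbers. *)
have hL n : iter n (move_head MoveLeft) (w.+1 * p) = (w.+1 * p - n)%N.
  by elim: n => /= [|n ->]; lia.
have hR n : iter n (move_head MoveRight) (w.+1 * p) = (w.+1 * p + n)%N.
  by elim: n => /= [|n ->]; lia.
have hS n : iter n (move_head Stay) (w.+1 * p) = (w.+1 * p)%N by elim: n.
have hd : iter w.+1 (move_head (dir_move d)) (w.+1 * p) = (w.+1 * move_head (dir_move d) p)%N.
  by case: d => [[]|]; rewrite [dir_move _]/= ?hL ?hR ?hS /=; nia.
pose f k := if k <= w.+1 then
    @Config block_program (BShift q (inord (w.+1 - k)) d) (iter k (move_head (dir_move d)) (w.+1 * p)) x W O
  else at_block q (move_head (dir_move d) p) W O.
have -> : @Config block_program (BShift q ord_max d) (w.+1 * p) x W O = f 0.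
  rewrite /f leq0n /= subn0; congr (@Config block_program (BShift _ _ _)).
  by apply/val_inj; rewrite /= inordK.
have -> : at_block q (move_head (dir_move d) p) W O = f w.+2 by rewrite /f ltnn.
apply: leads_iter => k kw; split.
  by rewrite /f kw; split => // j; left.
rewrite /f kw /step /=; case: ifP => [/eqP/(congr1 val)|/negbT].
  rewrite /= inordK ?ltnS ?leq_subr // => ek.
  have -> : k = w.+1 by lia.
  rewrite ltnn /= !write_id /at_block -iterS.
  by rewrite hd.
rewrite -val_eqE /= inordK ?ltnS ?leq_subr // => kw'.
have -> : k <= w by lia.
rewrite /= !write_id; congr (@Config block_program (BShift _ (inord _) _)); lia.
Qed.

Lemma block_step q p W O :
  let: (q', u, d) := bdelta q (block_content p W O) in
  let W' := update_tape p (fun o => (u o).1) W in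
  let O' := update_tape p (fun o => (u o).2) O in
  leads z (between W O W' O') (at_block q p W O)
    (at_block q' (move_head (dir_move d) p) W' O').
Proof.
have := read_phase q p W O; case: bdelta => [[q' u] d] r.
set W' := update_tape _ _ W; set O' := update_tape _ _ O.
apply: leads_trans (leads_trans (write_phase q' p u d W O) _).
  by apply: leads_weak r => c [? ? hW hO]; split => // j; [case: (hW j)|case: (hO j)]; auto.
apply: leads_weak (shift_phase q' p d _ _) => c [? ? hW hO].
by split => // j; [case: (hW j)|case: (hO j)]; auto.
Qed.

Lemma start_step W O : step z (@Config block_program BStart 0 x W O) = at_block (init false) 0 W O.
Proof. by rewrite /step /= !write_id /at_block muln0. Qed.

Lemma limit_step (W O : cantor_space) : W 0 ->
  step z (@Config block_program BLimit 0 x W O) = at_block (init true) 0 W O.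
Proof. by move=> W0; have e := write_id W 0; rewrite W0 in e; rewrite /step /= W0 /= e !write_id /at_block muln0. Qed.

Lemma limit_halt (W O : cantor_space) : W 0 = false ->
  step z (@Config block_program BLimit 0 x W O) = @Config block_program BHalt 0 x W O.
Proof. by move=> W0; have e := write_id W 0; rewrite W0 in e; rewrite /step /= W0 /= e !write_id. Qed.

End Blocks.

(** * An interpreter for sequences of operations *)

Inductive opcode :=
  | OLeft | ORight | OGate | OLoad | OWire | OInput of 'I_5 | OOut of 'I_5.

Definition opcode_encode (o : opcode) : 'I_5 + 'I_5 + 'I_5 :=
  match o with
  | OLeft => inl (inl (inord 0)) | ORight => inl (inl (inord 1))
  | OGate => inl (inl (inord 2)) | OLoad => inl (inl (inord 3))
  | OWire => inl (inl (inord 4)) | OInput i => inl (inr i) | OOut i => inr i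
  end.

Definition opcode_decode (s : 'I_5 + 'I_5 + 'I_5) : opcode :=
  match s with
  | inl (inl i) => nth OLeft [:: OLeft; ORight; OGate; OLoad; OWire] i
  | inl (inr i) => OInput i | inr i => OOut i
  end.

Lemma opcode_codeK : cancel opcode_encode opcode_decode.
Proof. by case=> //=; rewrite inordK. Qed.

HB.instance Definition _ := Finite.copy opcode (can_type opcode_codeK).

Definition word := {ffun 'I_5 -> bool}.

Definition opcode_of_word (b : word) : opcode :=
  nth OLeft (enum {: opcode}) (index b (enum {: word})).

Definition word_of_opcode (o : opcode) : word :=
  nth [ffun=> false] (enum {: word}) (index o (enum {: opcode})).

(** There are 32 words for at most 15 opcodes (five without argument and two families of five), so
    the index stays in range. *)
Lemma word_of_opcodeK : cancel word_of_opcode opcode_of_word.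
Proof.
move=> o; rewrite /opcode_of_word /word_of_opcode index_uniq ?enum_uniq //.
  by rewrite nth_index // mem_enum.
rewrite -cardE card_ffun card_bool card_ord.
apply: (@leq_trans #|{: opcode}|); first by rewrite cardE index_mem mem_enum.
apply: leq_trans (leq_card _ (can_inj opcode_codeK)) _.
by rewrite !card_sum !card_ord.
Qed.

(* [(live, t, f)]: [live] is false during the first sweep only, [t] and [f] hold
   the last value loaded, in dual-rail form. *)
Definition register := (bool * bool * bool)%type.

(** One instruction is a round trip: [MFind] runs right to the instruction mark, [MPlant] marks the
    next block and wipes a stale operand mark there, [MBack] runs left to the operand and executes,
    [MDrop] marks the new operand block. *)
Inductive mode :=
  | MInit of bool | MFind of register | MPlant of opcode & register
  | MBack of opcode & register | MDrop of register.

Definition mode_encode (m : mode) :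
    bool + register + opcode * register + opcode * register + register :=
  match m with
  | MInit b => inl (inl (inl (inl b))) | MFind r => inl (inl (inl (inr r)))
  | MPlant o r => inl (inl (inr (o, r))) | MBack o r => inl (inr (o, r))
  | MDrop r => inr r
  end.

Definition mode_decode s : mode :=
  match s with
  | inl (inl (inl (inl b))) => MInit b | inl (inl (inl (inr r))) => MFind r
  | inl (inl (inr (o, r))) => MPlant o r | inl (inr (o, r)) => MBack o r
  | inr r => MDrop r
  end.

Lemma mode_codeK : cancel mode_encode mode_decode.
Proof. by case. Qed.

HB.instance Definition _ := Finite.copy mode (can_type mode_codeK).

Definition off (k : nat) : 'I_5 := inord k.

Definition keep (v : block_view 4) : update 4 := [ffun o => ((v o).1.1.2, (v o).1.2)].
Definition set_work (u : update 4) (o : 'I_5) (b : bool) : update 4 :=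
  [ffun o' => (if o' == o then b else (u o').1, (u o').2)].
Definition set_out (u : update 4) (o : 'I_5) (b : bool) : update 4 :=
  [ffun o' => ((u o').1, if o' == o then b else (u o').2)].

Definition in_bit (v : block_view 4) o := (v o).1.1.1.
Definition work_bit (v : block_view 4) o := (v o).1.1.2.
Definition out_bit (v : block_view 4) o := (v o).1.2.

Definition op_register (op : opcode) (r : register) (v : block_view 4) : register :=
  match op with
  | OLoad => (r.1.1, work_bit v (off 1), work_bit v (off 2))
  | OInput o => (r.1.1, in_bit v o, ~~ in_bit v o)
  | _ => r
  end.

Definition op_update (op : opcode) (r : register) (v : block_view 4) : update 4 :=
  match op with
  | OGate => set_work (set_work (keep v) (off 1)
      (work_bit v (off 1) || (r.1.1 && ~~ work_bit v (off 0)))) (off 0) false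
  | OWire => set_work (set_work (keep v) (off 2) (work_bit v (off 2) || r.1.2))
      (off 0) (work_bit v (off 0) || ~~ r.2)
  | OOut o => set_out (keep v) o (out_bit v o || r.1.2)
  | _ => keep v
  end.

Definition op_dir (op : opcode) : direction :=
  match op with OLeft => Some false | ORight => Some true | _ => None end.

(* On the work tape, cells 0, 1 and 2 of block [g] hold the bits [U], [T] and [F]
   of gate [g]; cell 3 marks the next instruction and cell 4 the block on which
   it operates. Only the marks to the left of the next instruction are
   meaningful, so those left behind by a limit stage do no harm. *)
Definition interp (q : mode) (v : block_view 4) : mode * update 4 * direction :=
  match q with
  | MInit live => (MFind (live, false, false),
      set_work (set_work (keep v) (off 3) true) (off 4) true, None)
  | MFind r =>
      if work_bit v (off 3) then
        (MPlant (opcode_of_word [ffun o => (v o).2]) r,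
         set_work (keep v) (off 3) false, Some true)
      else (MFind r, keep v, Some true)
  | MPlant op r => (MBack op r,
      set_work (set_work (keep v) (off 3) true) (off 4) false, Some false)
  | MBack op r =>
      if work_bit v (off 4) then
        (MDrop (op_register op r v), set_work (op_update op r v) (off 4) false,
         op_dir op)
      else (MBack op r, keep v, Some false)
  | MDrop r => (MFind r, set_work (keep v) (off 4) true, None)
  end.

Definition machine : program := block_program MInit interp.

Record data := Data { dU : cantor_space; dT : cantor_space; dF : cantor_space;
                      dO : cantor_space }.

Definition tape_data (W O : cantor_space) : data :=
  Data (fun g => W (5 * g + 0)%N) (fun g => W (5 * g + 1)%N)
       (fun g => W (5 * g + 2)%N) O.

Definition config_data (c : config machine) := tape_data (cwork c) (coutput c).

Section Exec.
Variable x : cantor_space.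

Definition exec (op : opcode) (p : nat) (s : register * data) : register * data :=
  let: (r, D) := s in
  match op with
  | OLoad => ((r.1.1, dT D p, dF D p), D)
  | OInput o => ((r.1.1, x (5 * p + o)%N, ~~ x (5 * p + o)%N), D)
  | OGate => (r, Data (write (dU D) p false)
      (write (dT D) p (dT D p || (r.1.1 && ~~ dU D p))) (dF D) (dO D))
  | OWire => (r, Data (write (dU D) p (dU D p || ~~ r.2)) (dT D)
      (write (dF D) p (dF D p || r.1.2)) (dO D))
  | OOut o => (r, Data (dU D) (dT D) (dF D)
      (write (dO D) (5 * p + o)%N (dO D (5 * p + o)%N || r.1.2)))
  | _ => s
  end.

Definition either (A : Type) (u v w : nat -> A) := forall j, u j = v j \/ u j = w j.

(* [c] may be reached while the data change from [D] to [D']. *)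
Definition near_data (D D' : data) (c : config machine) :=
  [/\ cstate c <> halt machine,
      either (dU (config_data c)) (dU D) (dU D'),
      either (dT (config_data c)) (dT D) (dT D'),
      either (dF (config_data c)) (dF D) (dF D') &
      either (dO (config_data c)) (dO D) (dO D')].

Lemma near_between W O W' O' c : between x W O W' O' c ->
  near_data (tape_data W O) (tape_data W' O') c.
Proof. by move=> [h _ hW hO]; split => // j /=. Qed.

Lemma near_l D D' c : near_data D D c -> near_data D D' c.
Proof. by move=> [h hU hT hF hO]; split => // j; left; [case: (hU j)|case: (hT j)|case: (hF j)|case: (hO j)]. Qed.

Lemma near_r D D' c : near_data D' D' c -> near_data D D' c.
Proof. by move=> [h hU hT hF hO]; split => // j; right; [case: (hU j)|case: (hT j)|case: (hF j)|case: (hO j)]. Qed.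

Lemma update_set_work p u o b W :
  update_tape p (fun o' => (set_work u o b o').1) W =
  write (update_tape p (fun o' => (u o').1) W) (5 * p + o)%N b.
Proof.
have o4 : (o <= 4)%N by rewrite -ltnS.
apply/funext => j; rewrite /write divn_block // /update_tape ffunE /=.
case: eqP => //= _; rewrite -val_eqE /= inordK ?ltn_pmod //.
Qed.

Lemma update_set_work_out p u o b O :
  update_tape p (fun o' => (set_work u o b o').2) O =
  update_tape p (fun o' => (u o').2) O :> cantor_space.
Proof. by apply/funext => j; rewrite /update_tape ffunE. Qed.

Lemma update_set_out p u o b O :
  update_tape p (fun o' => (set_out u o b o').2) O =
  write (update_tape p (fun o' => (u o').2) O) (5 * p + o)%N b.
Proof.
have o4 : (o <= 4)%N by rewrite -ltnS.
apply/funext => j; rewrite /write divn_block // /update_tape ffunE /=.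
case: eqP => //= _; rewrite -val_eqE /= inordK ?ltn_pmod //.
Qed.

Lemma update_set_out_work p u o b W :
  update_tape p (fun o' => (set_out u o b o').1) W =
  update_tape p (fun o' => (u o').1) W :> cantor_space.
Proof. by apply/funext => j; rewrite /update_tape ffunE. Qed.

Variable z : cantor_space.

Lemma update_keep_work p W O :
  update_tape p (fun o => (keep (block_content 4 z x p W O) o).1) W = W.
Proof.
apply/funext => j; rewrite /update_tape !ffunE /=; case: eqP => // <-.
by rewrite inordK ?ltn_pmod // mulnC -divn_eq.
Qed.

Lemma update_keep_out p W O :
  update_tape p (fun o => (keep (block_content 4 z x p W O) o).2) O = O.
Proof.
apply/funext => j; rewrite /update_tape !ffunE /=; case: eqP => // <-.
by rewrite inordK ?ltn_pmod // mulnC -divn_eq.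
Qed.

Definition updateE := (update_set_work, update_set_work_out, update_set_out,
  update_set_out_work, update_keep_work, update_keep_out).

Lemma work_bitE p W O k : k < 5 ->
  work_bit (block_content 4 z x p W O) (off k) = W (5 * p + k)%N.
Proof. by move=> k5; rewrite /work_bit ffunE /= inordK. Qed.

Local Notation at_mode := (@at_block 4 mode MInit interp x).

Lemma interp_step q p W O q' W' O' u d :
  interp q (block_content 4 z x p W O) = (q', u, d) ->
  update_tape p (fun o => (u o).1) W = W' ->
  update_tape p (fun o => (u o).2) O = O' ->
  leads z (near_data (tape_data W O) (tape_data W' O')) (at_mode q p W O)
    (at_mode q' (move_head (dir_move d) p) W' O').
Proof.
move=> E <- <-; have := @block_step 4 mode MInit interp z x q p W O.
rewrite E; apply: leads_weak => c; exact: near_between.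
Qed.

Lemma writeE (W : cantor_space) i j a c b : a < 5 -> c < 5 ->
  write W (5 * i + a) b (5 * j + c)%N =
  if (j == i) && (c == a) then b else W (5 * j + c)%N.
Proof.
move=> a5 c5; rewrite /write; have -> // : (5 * j + c == 5 * i + a)%N = (j == i) && (c == a).
by apply/eqP/andP => [h|[/eqP -> /eqP ->]//]; split; apply/eqP; lia.
Qed.

Lemma tape_data_write3 W O p b : tape_data (write W (5 * p + 3) b) O = tape_data W O.
Proof. by congr Data; apply/funext => g; rewrite writeE // andbF. Qed.

Lemma tape_data_write4 W O p b : tape_data (write W (5 * p + 4) b) O = tape_data W O.
Proof. by congr Data; apply/funext => g; rewrite writeE // andbF. Qed.

Lemma tape_data_write0 W O p b : tape_data (write W (5 * p + 0) b) O =
  let D := tape_data W O in Data (write (dU D) p b) (dT D) (dF D) (dO D).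
Proof. by congr Data; apply/funext => g; rewrite writeE // ?andbF ?andbT. Qed.

Lemma tape_data_write1 W O p b : tape_data (write W (5 * p + 1) b) O =
  let D := tape_data W O in Data (dU D) (write (dT D) p b) (dF D) (dO D).
Proof. by congr Data; apply/funext => g; rewrite writeE // ?andbF ?andbT. Qed.

Lemma tape_data_write2 W O p b : tape_data (write W (5 * p + 2) b) O =
  let D := tape_data W O in Data (dU D) (dT D) (write (dF D) p b) (dO D).
Proof. by congr Data; apply/funext => g; rewrite writeE // ?andbF ?andbT. Qed.

Definition tape_dataE := (tape_data_write0, tape_data_write1, tape_data_write2,
  tape_data_write3, tape_data_write4).

Variable I : nat -> opcode.
Hypothesis zI : forall k, opcode_of_word [ffun o : 'I_5 => z (5 * k + o)%N] = I k.

Lemma find_mark r p k W O : p <= k -> (forall i, i <= k -> W (5 * i + 3)%N = (i == k)) ->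
  leads z (near_data (tape_data W O) (tape_data W O)) (at_mode (MFind r) p W O)
    (at_mode (MPlant (I k) r) k.+1 (write W (5 * k + 3) false) O).
Proof.
move=> pk hW; have [n] : exists n, (p + n)%N = k by exists (k - p)%N; lia.
elim: n p pk => [|n ih] p pk pnk.
  have -> : p = k by lia.
  rewrite -{2}(tape_data_write3 W O k false).
  apply: (@interp_step _ _ _ _ _ _ _
    (set_work (keep (block_content 4 z x k W O)) (off 3) false) (Some true)).
  - rewrite /interp work_bitE // hW // eqxx; congr (MPlant _ _, _, _).
    by rewrite -zI; congr opcode_of_word; apply/ffunP => o; rewrite !ffunE.
  - by rewrite !updateE inordK.
  - by rewrite !updateE.
apply: leads_trans (ih p.+1 _ _); [|lia|lia].
apply: (@interp_step _ _ _ _ _ _ _ (keep (block_content 4 z x p W O)) (Some true)).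
- by rewrite /interp work_bitE // hW //; have -> : (p == k) = false by lia.
- by rewrite !updateE.
- by rewrite !updateE.
Qed.

Lemma op_updateE op p r W O : let v := block_content 4 z x p W O in
  let W' := update_tape p (fun o => (op_update op r v o).1) W in
  let O' := update_tape p (fun o => (op_update op r v o).2) O in
  exec op p (r, tape_data W O) = (op_register op r v, tape_data W' O') /\
  (forall i a, 2 < a < 5 -> W' (5 * i + a)%N = W (5 * i + a)%N).
Proof.
case: op => [| | | | |o|o]; rewrite /op_update ?updateE /op_register ?work_bitE //= ?inordK //.
- rewrite !tape_dataE; split=> [//|i a /andP [a2 a5]].
  rewrite !writeE //; have [-> ->] : (a == 0) = false /\ (a == 1) = false by lia.
  by rewrite !andbF.
- rewrite !tape_dataE; split=> [//|i a /andP [a2 a5]].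
  rewrite !writeE //; have [-> ->] : (a == 0) = false /\ (a == 2) = false by lia.
  by rewrite !andbF.
- by rewrite /in_bit ffunE.
- by rewrite /out_bit ffunE.
Qed.

Definition op_move op p := move_head (dir_move (op_dir op)) p.

Lemma go_back op r p k W O : p <= k -> (forall i, i <= k -> W (5 * i + 4)%N = (i == p)) ->
  let s := exec op p (r, tape_data W O) in
  exists W' O', [/\ tape_data W' O' = s.2,
    forall i a, 2 < a < 5 -> W' (5 * i + a)%N = write W (5 * p + 4) false (5 * i + a)%N &
    leads z (near_data (tape_data W O) s.2) (at_mode (MBack op r) k W O)
      (at_mode (MDrop s.1) (op_move op p) W' O')].
Proof.
move=> pk hW s; set v := block_content 4 z x p W O.
have [es hm] := op_updateE op p r W O; rewrite -/v in es hm.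
pose W1 := update_tape p (fun o => (op_update op r v o).1) W.
pose O1 := update_tape p (fun o => (op_update op r v o).2) O.
exists (write W1 (5 * p + 4) false), O1; rewrite tape_dataE /s es; split=> //.
  move=> i a ha; have /andP [_ a5] := ha.
  by rewrite !writeE // /W1 hm.
have [n] : exists n, (p + n)%N = k by exists (k - p)%N; lia.
elim: n k {pk} hW => [|n ih] k hW pnk.
  have -> : k = p by lia.
  rewrite -[in X in near_data _ X](tape_data_write4 _ _ p false).
  apply: (@interp_step _ _ _ _ _ _ _ (set_work (op_update op r v) (off 4) false)).
  - by rewrite /interp work_bitE // hW ?eqxx //; lia.
  - by rewrite !updateE inordK.
  - by rewrite !updateE.
case: k hW pnk => [|k] hW pnk; first by lia.
apply: leads_trans (ih k _ _); [|by move=> i ik; apply: hW; lia|lia].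
apply: leads_weak (@near_l _ (tape_data W1 O1)) _.
apply: (@interp_step _ _ _ _ _ _ _ (keep (block_content 4 z x k.+1 W O)) (Some false)).
- by rewrite /interp work_bitE // hW //; have -> : (k.+1 == p) = false by lia.
- by rewrite !updateE.
- by rewrite !updateE.
Qed.

(** The bound [p <= k] lets the leftward scan find the operand. It persists because the instruction
    mark advances by one block while the operand moves by at most one. *)
Definition marked k p (W : cantor_space) := [/\ p <= k,
  forall i, i <= k -> W (5 * i + 3)%N = (i == k) &
  forall i, i <= k -> W (5 * i + 4)%N = (i == p)].

Lemma instruction_step k p r W O : marked k p W ->
  let s := exec (I k) p (r, tape_data W O) in
  exists W' O', [/\ tape_data W' O' = s.2, marked k.+1 (op_move (I k) p) W' &
    leads z (near_data (tape_data W O) s.2) (at_mode (MFind r) p W O)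
      (at_mode (MFind s.1) (op_move (I k) p) W' O')].
Proof.
move=> [pk h3 h4] s; pose W1 := write W (5 * k + 3) false.
pose W2 := write (write W1 (5 * k.+1 + 3) true) (5 * k.+1 + 4) false.
have e2 : tape_data W2 O = tape_data W O by rewrite /W2 /W1 !tape_dataE.
have h2 i : i <= k -> W2 (5 * i + 4)%N = (i == p).
  move=> ik; rewrite /W2 /W1 !writeE //= !andbF h4 //.
  by have -> : (i == k.+1) = false by lia.
have [W3 [V3 [e3 h h3']]] := go_back (I k) r O pk h2.
rewrite e2 -/s in e3 h3'.
set p' := op_move _ _ in h3' *.
have p'k : p' <= k.+1 by rewrite /p' /op_move; case: (I k) => //=; lia.
exists (write W3 (5 * p' + 4) true), V3; rewrite tape_dataE; split=> //.
  split=> [//|i ik|i ik]; rewrite writeE // ?andbF ?andbT h // writeE // ?andbF ?andbT /W2 /W1 !writeE // ?andbF ?andbT /=.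
    case: (altP (i =P k.+1)) => // nk; case: (altP (i =P k)) => [//|nk'].
    by rewrite h3; lia.
  case: (altP (i =P p')) => // np'; case: (altP (i =P p)) => // np.
  case: (altP (i =P k.+1)) => // nk.
  by rewrite h4 //; lia.
apply: leads_trans (leads_weak (@near_l _ _) (find_mark r O pk h3)) _.
have st2 : leads z (near_data (tape_data W O) s.2) (at_mode (MPlant (I k) r) k.+1 W1 O)
    (at_mode (MBack (I k) r) k W2 O).
  have e1 : tape_data W1 O = tape_data W O by rewrite /W1 !tape_dataE.
  apply: leads_weak (@near_l _ _) _; rewrite -{1}e1 -{1}e2.
  apply: (@interp_step _ _ _ _ _ _ _ (set_work (set_work (keep _) (off 3) true) (off 4) false) (Some false)).
  - by [].
  - by rewrite !updateE !inordK.
  - by rewrite !updateE.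
apply: leads_trans st2 (leads_trans h3' _).
apply: leads_weak (@near_r _ _) _; rewrite -e3 -{2}(tape_data_write4 W3 V3 p' true).
apply: (@interp_step _ _ _ _ _ _ _ (set_work (keep _) (off 4) true) None).
- by [].
- by rewrite !updateE !inordK.
- by rewrite !updateE.
Qed.

End Exec.

(** * Compiling a schedule of addressed operations into the parameter tape *)

Section Stream.
Variable J : nat -> nat * opcode.
Hypothesis J_static : forall i, op_dir (J i).2 = None.

(** Finitely many opcodes cannot name a block, so addresses are unary: walk right, operate, and
    return to block 0. *)
Definition visit (i : nat) : seq opcode :=
  nseq (J i).1 ORight ++ (J i).2 :: nseq (J i).1 OLeft.

Definition position (i : nat) : nat := size (flatten [seq visit j | j <- iota 0 i]).

Definition stream (k : nat) : opcode :=
  nth OLeft (flatten [seq visit j | j <- iota 0 k.+1]) k.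

Lemma size_visit i : size (visit i) = ((J i).1 + (J i).1).+1.
Proof. by rewrite size_cat /= !size_nseq addnS. Qed.

Lemma positionS i : position i.+1 = (position i + size (visit i))%N.
Proof. by rewrite /position -addn1 iotaD map_cat flatten_cat size_cat /= cats0. Qed.

Lemma position_ge i : i <= position i.
Proof. by elim: i => // i ih; rewrite positionS size_visit; lia. Qed.

Lemma position_block k : exists i, position i <= k < position i.+1.
Proof.
elim: k => [|k [i /andP [ik ki]]]; first by exists 0; rewrite positionS size_visit.
case: (leqP (position i.+1) k.+1) => h; last by exists i; rewrite h (leqW ik).
by exists i.+1; rewrite h positionS size_visit; lia.
Qed.

Lemma streamE i j : j < size (visit i) -> stream (position i + j) = nth OLeft (visit i) j.
Proof.
move=> ji; rewrite /stream; have ip := position_ge i.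
have -> : (position i + j).+1 = (i + (1 + (position i + j - i)))%N by lia.
rewrite !iotaD !map_cat !flatten_cat nth_cat -/(position i) ltnNge leq_addr /=.
by rewrite cats0 addKn nth_cat ji.
Qed.

Definition code_tape : cantor_space :=
  fun j => word_of_opcode (stream (j %/ 5)) (inord (j %% 5)).

Lemma code_tapeP k : opcode_of_word [ffun o : 'I_5 => code_tape (5 * k + o)%N] = stream k.
Proof.
rewrite -[RHS]word_of_opcodeK; congr opcode_of_word; apply/ffunP => o.
rewrite ffunE /code_tape mulnC divnMDl // divn_small // addn0 modnMDl modn_small //.
by congr (word_of_opcode _ _); apply/val_inj; rewrite /= inordK.
Qed.

Variable x : cantor_space.

Fixpoint stage (s : register * data) (i : nat) : register * data :=
  if i is i'.+1 then exec x (J i').2 (J i').1 (stage s i') else s.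

Fixpoint micro (s : register * data) (k : nat) : nat * (register * data) :=
  if k is k'.+1 then
    let: (p, s') := micro s k' in (op_move (stream k') p, exec x (stream k') p s')
  else (0, s).

(** [ORight] and [OLeft] leave register and data alone, so the state changes only at the middle
    opcode of the visit. *)
Lemma micro_visit s i j : micro s (position i) = (0, stage s i) ->
  j < size (visit i) ->
  micro s (position i + j) = if j <= (J i).1 then (j, stage s i)
    else ((J i).1 + (J i).1 - j.-1, stage s i.+1)%N.
Proof.
move=> e0; elim: j => [|j ih] ji; first by rewrite addn0.
rewrite addnS [micro _ _.+1]/= ih ?streamE; [|lia|lia].
rewrite size_visit in ji.
rewrite /visit nth_cat size_nseq; case: (ltngtP j (J i).1) => jq.
- by rewrite nth_nseq jq /= /op_move /=; case: (stage s i).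
- have -> : (j - (J i).1)%N = (j - (J i).1).-1.+1 by lia.
  rewrite /= nth_nseq; have -> : ((j - (J i).1).-1 < (J i).1)%N by lia.
  rewrite /op_move /=; case: (exec _ _ _ (stage s i)) => r D.
  by congr pair; lia.
- rewrite jq subnn /= /op_move J_static /=.
  by congr pair; lia.
Qed.

Lemma micro_position s i : micro s (position i) = (0, stage s i).
Proof.
elim: i => [//|i ih]; rewrite positionS size_visit addnS [micro _ _.+1]/=.
rewrite micro_visit // ?streamE ?size_visit //.
rewrite /visit nth_cat size_nseq.
case: ifP => h.
  have q0 : (J i).1 = 0 by lia.
  by rewrite /op_move q0 /= J_static q0.
have -> : ((J i).1 + (J i).1 < (J i).1)%N = false by lia.
rewrite addnK; have [q eq] : exists q, (J i).1 = q.+1 by exists (J i).1.-1; lia.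
have -> : nth OLeft ((J i).2 :: nseq (J i).1 OLeft) (J i).1 = OLeft.
  by rewrite {2}eq /= nth_nseq eq leqnn.
rewrite /op_move.
by case: (stage s i.+1) => r D; congr pair => /=; lia.
Qed.

Lemma micro_stage s k : exists2 i, position i <= k < position i.+1 &
  ((micro s k).2 = stage s i \/ (micro s k).2 = stage s i.+1) /\
  ((micro s k.+1).2 = stage s i \/ (micro s k.+1).2 = stage s i.+1).
Proof.
have [i /andP [ik ki]] := position_block k; exists i; first by rewrite ik.
have m j : j < size (visit i) -> (micro s (position i + j)).2 = stage s i \/
    (micro s (position i + j)).2 = stage s i.+1.
  by move=> ji; rewrite micro_visit ?micro_position //; case: ifP; auto.
move: ki; rewrite positionS -(subnKC ik) ltn_add2l => ki; split; first exact: m.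
rewrite -addnS; case: (ltngtP (k - position i).+1 (size (visit i))) => h.
- exact: m.
- by rewrite ltnNge ki in h.
- by right; rewrite h -positionS micro_position.
Qed.

Lemma near_mix (A B D D' : data) c : (D = A \/ D = B) -> (D' = A \/ D' = B) ->
  near_data D D' c -> near_data A B c.
Proof.
move=> [->|->] [->|->] [h hU hT hF hO]; split => // j;
  by move: (hU j) (hT j) (hF j) (hO j); tauto.
Qed.

Local Notation at_mode := (@at_block 4 mode MInit interp x).
Local Notation stepz := (@step machine code_tape).

Lemma micro_run s k p r W O d : marked k p W -> micro s k = (p, (r, tape_data W O)) ->
  exists N p' r' W' O', [/\ d <= N,
    iter N stepz (at_mode (MFind r) p W O) = at_mode (MFind r') p' W' O',
    marked (k + d) p' W', micro s (k + d) = (p', (r', tape_data W' O')) &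
    forall n, n < N -> exists2 k', k <= k' &
      near_data (micro s k').2.2 (micro s k'.+1).2.2
        (iter n stepz (at_mode (MFind r) p W O))].
Proof.
move=> mk ek; elim: d => [|d [N [p1 [r1 [W1 [V1 [dN eN m1 e1 h]]]]]]].
  by exists 0, p, r, W, O; rewrite addn0.
have [W2 [V2 [e2 m2 [n [en hn]]]]] := instruction_step x code_tapeP r1 V1 m1.
have e3 : micro s (k + d).+1 = (op_move (stream (k + d)) p1,
    exec x (stream (k + d)) p1 (r1, tape_data W1 V1)).
  by rewrite /= e1.
exists (n.+1 + N)%N; do 4 eexists; rewrite addnS; split.
- by lia.
- by rewrite iterD eN en.
- exact: m2.
- by rewrite e3 e2 -surjective_pairing.
move=> n' n'N; case: (ltnP n' N) => [/h //|nn'].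
exists (k + d)%N; first exact: leq_addr.
rewrite e3 e1 /=.
have -> : n' = (n' - N + N)%N by lia.
by rewrite iterD eN; apply: hn; lia.
Qed.

(** The first clause bounds what a lim sup can see during the sweep. The second says that eventually
    only arbitrarily late stages are visible. *)
Lemma sweep live W O : let s := stage (live, false, false, tape_data W O) in
  let c := at_mode (MInit live) 0 W O in
  (forall n, exists i, near_data (s i).2 (s i.+1).2 (iter n stepz c)) /\
  (forall i, exists N, forall n, N <= n -> exists2 i', i <= i' &
     near_data (s i').2 (s i'.+1).2 (iter n stepz c)).
Proof.
set s0 := (live, false, false, tape_data W O); move=> s c.
pose W0 := write (write W (5 * 0 + 3) true) (5 * 0 + 4) true.
have e0 : tape_data W0 O = tape_data W O by rewrite /W0 !tape_dataE.
have [n0 [en0 hn0]] : leads code_tape (near_data (tape_data W O) (tape_data W O)) c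
    (at_mode (MFind (live, false, false)) 0 W0 O).
  rewrite -{2}e0; apply: (@interp_step _ _ _ _ _ _ _ _ _
    (set_work (set_work (keep _) (off 3) true) (off 4) true) None).
  - by [].
  - by rewrite !updateE !inordK.
  - by rewrite !updateE.
have m0 : marked 0 0 W0.
  by split=> // i; rewrite leqn0 => /eqP ->.
have i0 : micro s0 0 = (0, (live, false, false, tape_data W0 O)) by rewrite e0.
have key i : exists N, forall n, N <= n -> exists2 i', i <= i' &
     near_data (s i').2 (s i'.+1).2 (iter n stepz c).
  have [N [p' [r' [W' [V' [dN eN m' e' h]]]]]] := micro_run (position i) m0 i0.
  exists (N + n0.+1)%N => n hn.
  have [N' [p2 [r2 [W2 [V2 [dN' _ _ _ h']]]]]] := micro_run n.+1 m' e'.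
  have [|k' kk'] := h' (n - (N + n0.+1))%N; first by lia.
  rewrite -eN -en0 -!iterD -?addnA.
  have -> : (n - (N + n0.+1) + (N + n0.+1) = n)%N by lia.
  have [i' /andP [_ ik] [h1 h2]] := micro_stage s0 k'.
  move=> nr; exists i'; last by apply: near_mix nr; rewrite /s; [case: h1|case: h2] => ->; auto.
  rewrite leqNgt; apply/negP => ii; have : (position i'.+1 <= position i)%N.
    have mono a b : (position a <= position (b + a))%N.
      by elim: b => // b ihb; rewrite addSn positionS; apply: leq_trans ihb (leq_addr _ _).
    by rewrite -(subnK ii); exact: mono.
  by move: kk' ik; rewrite add0n; lia.
split=> // n; case: (leqP n n0) => nn0.
  by exists 0; apply: near_l; exact: hn0.
have [N [p' [r' [W' [V' [dN eN m' e' h]]]]]] := micro_run n.+1 m0 i0.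
have [|k' _] := h (n - n0.+1)%N; first by lia.
rewrite -en0 -!iterD.
have -> : (n - n0.+1 + n0.+1 = n)%N by lia.
have [i' _ [h1 h2]] := micro_stage s0 k'.
by move=> nr; exists i'; apply: near_mix nr; rewrite /s; [case: h1|case: h2] => ->; auto.
Qed.

End Stream.

(** * Evaluating a circuit *)

(** Each [K] codes a sequence, whose first two entries (default 0) name a gate and one of its
    arguments; every pair occurs. *)
Definition wire_gate (K : nat) : nat := nth 0 (CodeSeq.decode K) 0.
Definition wire_index (K : nat) : nat := nth 0 (CodeSeq.decode K) 1.

Lemma code_cons_gt n s : n < CodeSeq.code (n :: s).
Proof.
rewrite /CodeSeq.code /= -/(CodeSeq.code s).
apply: leq_trans (ltn_expl n (ltnSn 1)) _; rewrite leq_pmulr //.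
Qed.

(** Consequently, in each sweep the flag of [g] is cleared in round [g] before any wire into [g] can
    set it. *)
Lemma wire_gate_le K : wire_gate K <= K.
Proof.
rewrite /wire_gate -{2}(CodeSeq.decodeK K); case: CodeSeq.decode => //= n s.
exact: ltnW (code_cons_gt n s).
Qed.

Lemma wire_onto g n : exists K, wire_gate K = g /\ wire_index K = n.
Proof. by exists (CodeSeq.code [:: g; n]); rewrite /wire_gate /wire_index CodeSeq.codeK. Qed.

(* All gates are infinitary NOR gates; [kid g n] is the [n]-th argument of gate
   [g], either another gate or a bit of the input. The argument read in round
   [K] of a sweep is also or-ed into output cell [n] if [wire_out K = Some n]. *)
Section Circuit.
Variable kid : nat -> nat -> nat + nat.
Variable wire_out : nat -> option nat.

Definition wire_src K := kid (wire_gate K) (wire_index K).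

Definition load_op K : nat * opcode :=
  match wire_src K with
  | inl j => (j, OLoad) | inr i => (i %/ 5, OInput (inord (i %% 5)))
  end.

(** Round [K] has four slots: test and clear gate [K], load the argument of wire [K], copy it to the
    output, feed it to its gate. If there is nothing to output, the load is repeated, so that all
    rounds have equal length. *)
Definition schedule (i : nat) : nat * opcode :=
  let K := i %/ 4 in
  match i %% 4 with
  | 0 => (K, OGate)
  | 1 => load_op K
  | 2 => if wire_out K is Some n then (n %/ 5, OOut (inord (n %% 5))) else load_op K
  | _ => (wire_gate K, OWire)
  end.

Lemma scheduleE K b : b < 4 -> schedule (4 * K + b) =
  match b with
  | 0 => (K, OGate)
  | 1 => load_op K
  | 2 => if wire_out K is Some n then (n %/ 5, OOut (inord (n %% 5))) else load_op K
  | _ => (wire_gate K, OWire)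
  end.
Proof.
by move=> b4; rewrite /schedule mulnC divnMDl // divn_small // addn0 modnMDl modn_small.
Qed.

Lemma schedule_static i : op_dir (schedule i).2 = None.
Proof.
rewrite /schedule /load_op; case: (i %% 4) => [|[|[|b]]] //=.
  by case: wire_src.
by case: wire_out => //; case: wire_src.
Qed.

Variable x : cantor_space.
Variable value : nat -> bool.

Definition source_value (s : nat + nat) : bool :=
  match s with inl j => value j | inr i => x i end.

Definition known_true (D : data) (s : nat + nat) : bool :=
  match s with inl j => dT D j | inr i => x i end.

Definition known_false (D : data) (s : nat + nat) : bool :=
  match s with inl j => dF D j | inr i => ~~ x i end.

Definition all_false (D : data) (g : nat) := forall n, known_false D (kid g n).

Variables (y : cantor_space) (check_gate : nat -> nat).
Record sound (D : data) : Prop := Sound {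
  sound_T : forall g, dT D g -> value g;
  sound_F : forall g, dF D g -> ~~ value g;
  sound_O : forall n, dO D n -> y n;
  sound_check : forall n, dF D (check_gate n) -> dO D n = y n }.

Lemma known_true_sound D s : sound D -> known_true D s -> source_value s.
Proof. by case: s => [j|i] //= sD; exact: sound_T. Qed.

Lemma known_false_sound D s : sound D -> known_false D s -> ~~ source_value s.
Proof. by case: s => [j|i] //= sD; exact: sound_F. Qed.

(** The flags [dU] are left out: they are cleared and set anew in every sweep. *)
Definition data_le (D D' : data) := [/\ forall g, dT D g -> dT D' g,
  forall g, dF D g -> dF D' g & forall g, dO D g -> dO D' g].

Lemma data_le_refl D : data_le D D.
Proof. by []. Qed.

Lemma data_le_trans D2 D1 D3 : data_le D1 D2 -> data_le D2 D3 -> data_le D1 D3.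
Proof.
by move=> [t f o] [t' f' o']; split=> g h; [exact/t'/t|exact/f'/f|exact/o'/o].
Qed.

Lemma known_false_le D D' s : data_le D D' -> known_false D s -> known_false D' s.
Proof. by case: s => //= j [_ + _]; apply. Qed.

Lemma known_true_le D D' s : data_le D D' -> known_true D s -> known_true D' s.
Proof. by case: s => //= j [+ _ _]; apply. Qed.

Lemma exec_le op p s : data_le s.2 (exec x op p s).2.
Proof.
case: s => r D; case: op => //= [||o]; split=> //= g; rewrite /write; case: eqP => // -> ->.
- by [].
- by [].
- by [].
Qed.

Variables (live : bool) (D0 : data).
Definition cstage := stage schedule x (live, false, false, D0).

Lemma cstage_le i j : i <= j -> data_le (cstage i).2 (cstage j).2.
Proof.
move=> ij; rewrite -(subnKC ij); elim: (j - i)%N => [|n ih].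
  by rewrite addn0; exact: data_le_refl.
rewrite addnS; apply: data_le_trans ih _; exact: exec_le.
Qed.

Lemma cstage_step i : cstage i.+1 = exec x (schedule i).2 (schedule i).1 (cstage i).
Proof. by []. Qed.

Lemma cstage_live i : (cstage i).1.1.1 = live.
Proof.
elim: i => // i ih; rewrite cstage_step; case: (cstage i) ih => [[[l t] f] D] /= ->.
by case: (schedule i).2.
Qed.

Lemma div4 i : exists K b, b < 4 /\ i = (4 * K + b)%N.
Proof. by exists (i %/ 4), (i %% 4); rewrite ltn_pmod // mulnC -divn_eq. Qed.

Lemma cstage_gate K : cstage (4 * K + 1) = ((cstage (4 * K)).1,
  let D := (cstage (4 * K)).2 in Data (write (dU D) K false)
    (write (dT D) K (dT D K || (live && ~~ dU D K))) (dF D) (dO D)).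
Proof.
have eJ := @scheduleE K 0 isT; rewrite addn0 in eJ.
rewrite addn1 cstage_step eJ; have := cstage_live (4 * K); case: (cstage (4 * K)) => r D /= ->.
by [].
Qed.

Lemma exec_load K r D : exec x (load_op K).2 (load_op K).1 (r, D) =
  ((r.1.1, known_true D (wire_src K), known_false D (wire_src K)), D).
Proof.
rewrite /load_op; case: wire_src => //= i; rewrite inordK ?ltn_pmod //.
by rewrite mulnC -divn_eq.
Qed.

Lemma cstage_load K : cstage (4 * K + 2) = (let D := (cstage (4 * K + 1)).2 in
  (live, known_true D (wire_src K), known_false D (wire_src K)), (cstage (4 * K + 1)).2).
Proof.
rewrite (addnS _ 1) cstage_step scheduleE //.
by have := cstage_live (4 * K + 1); case: (cstage _) => r D /= <-; exact: exec_load.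
Qed.

Lemma cstage_out K : cstage (4 * K + 3) = ((cstage (4 * K + 2)).1,
  let D := (cstage (4 * K + 2)).2 in
  Data (dU D) (dT D) (dF D) (if wire_out K is Some n
    then write (dO D) n (dO D n || known_true D (wire_src K)) else dO D)).
Proof.
rewrite (addnS _ 2) cstage_step scheduleE // cstage_load.
case: wire_out => [n|]; last by rewrite exec_load; case: (cstage _).2.
have en : (5 * (n %/ 5) + n %% 5)%N = n by rewrite mulnC -divn_eq.
by rewrite /= inordK ?ltn_pmod // en.
Qed.

Lemma cstage_wire K : cstage (4 * K.+1) = ((cstage (4 * K + 3)).1,
  let D := (cstage (4 * K + 3)).2 in let g := wire_gate K in
  Data (write (dU D) g (dU D g || ~~ known_false D (wire_src K))) (dT D)
    (write (dF D) g (dF D g || known_true D (wire_src K))) (dO D)).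
Proof.
rewrite mulnS addnC (addnS _ 3) cstage_step scheduleE // cstage_out cstage_load /=.
by case: wire_src.
Qed.

Lemma next_block K : (4 * K + 3).+1 = (4 * K.+1)%N.
Proof. by lia. Qed.

Lemma leq_writeP (u : cantor_space) p b g : write u p b g -> u g \/ (g = p /\ b).
Proof. by rewrite /write; case: eqP => [->|_]; auto. Qed.

(** Thus [OGate] tests exactly the flag left by the preceding limit stage. *)
Lemma cstage_U_before g i : i <= 4 * g -> dU (cstage i).2 g = dU D0 g.
Proof.
elim: i => // i ih ig; rewrite -ih; last exact: ltnW.
have [K [b [b4 ei]]] := div4 i; rewrite ei in ig *.
case: b b4 ig {ih ei} => [|[|[|[|//]]]] _ ig.
- rewrite addn0 -[(4 * K).+1]addn1 cstage_gate /= /write; case: eqP => // eg; lia.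
- by rewrite -(addnS _ 1) cstage_load.
- by rewrite -(addnS _ 2) cstage_out.
- rewrite next_block cstage_wire /= /write; case: eqP => // eg.
  by have := wire_gate_le K; lia.
Qed.

Lemma cstage_U_after g i : 4 * g < i -> dU (cstage i).2 g -> dU (cstage i.+1).2 g.
Proof.
have [K [b [b4 ->]]] := div4 i.
case: b b4 => [|[|[|[|//]]]] _ ig.
- rewrite addn0 -[(4 * K).+1]addn1 cstage_gate /= /write; case: eqP => // eg; lia.
- by rewrite -(addnS _ 1) cstage_load.
- by rewrite -(addnS _ 2) cstage_out.
- by rewrite next_block cstage_wire /= /write; case: eqP => // -> ->.
Qed.

Lemma cstage_U_later g i j : 4 * g < i -> i <= j -> dU (cstage i).2 g -> dU (cstage j).2 g.
Proof.
move=> gi ij; rewrite -(subnKC ij); elim: (j - i)%N => [|n ih]; first by rewrite addn0.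
by move=> /ih; rewrite addnS; apply: cstage_U_after; lia.
Qed.

Lemma cstage_gate_true g : live -> dU D0 g = false -> dT (cstage (4 * g + 1)).2 g.
Proof.
move=> l u0; rewrite cstage_gate /= /write eqxx cstage_U_before // u0 l; exact: orbT.
Qed.

Lemma cstage_kid_true g n : known_true D0 (kid g n) -> exists i, dF (cstage i).2 g.
Proof.
move=> kt; have [K [eg en]] := wire_onto g n; exists (4 * K.+1)%N.
rewrite cstage_wire /= /write eg eqxx; have -> : known_true (cstage (4 * K + 3)).2 (wire_src K).
  by rewrite /wire_src eg en; apply: known_true_le kt; exact: (@cstage_le 0).
exact: orbT.
Qed.

Lemma cstage_all_false g i : all_false D0 g -> 4 * g < i -> dU (cstage i).2 g = false.
Proof.
move=> af; elim: i => // i ih; rewrite ltnS leq_eqVlt => /orP [/eqP <-|gi].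
  by rewrite -[(4 * g).+1]addn1 cstage_gate /= /write eqxx.
have {ih} := ih gi; have [K [b [b4 ->]]] := div4 i.
case: b b4 {gi} => [|[|[|[|//]]]] _ ih.
- by rewrite addn0 -[(4 * K).+1]addn1 cstage_gate /= /write; case: eqP => // _; move: ih; rewrite addn0.
- by rewrite -(addnS _ 1) cstage_load.
- by rewrite -(addnS _ 2) cstage_out.
- rewrite next_block cstage_wire /= /write; case: eqP => // eg.
  rewrite -eg ih /=; apply/negbTE; rewrite negbK /wire_src -eg.
  by apply: known_false_le (af _); exact: (@cstage_le 0).
Qed.

(** An argument not known to be false at its wire would set the flag, and nothing clears it later in
    the sweep. A flag that is 0 cofinally in a single sweep therefore certifies all arguments. *)
Lemma cstage_unmarked g : (forall i, exists2 i', i <= i' & dU (cstage i').2 g = false) ->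
  forall n, exists i, known_false (cstage i).2 (kid g n).
Proof.
move=> h n; have [K [eg en]] := wire_onto g n; exists (4 * K + 3)%N.
have gK := wire_gate_le K; have [i' Ki' u0] := h (4 * K.+1)%N.
rewrite -en -eg -/(wire_src K); apply: contraFT u0 => kf.
have gK' : 4 * g < 4 * K.+1 by lia.
apply: (cstage_U_later gK' Ki'); rewrite cstage_wire /= /write eg eqxx kf; exact: orbT.
Qed.

Hypothesis valueP : forall g, value g <-> forall n, ~~ source_value (kid g n).

Hypothesis check0 : forall n, source_value (kid (check_gate n) 0) = y n.
Hypothesis checkS : forall n k, source_value (kid (check_gate n) k.+1) = ~~ y n.
Hypothesis wire_outP : forall K n, wire_out K = Some n <->
  wire_gate K = check_gate n /\ wire_index K = 0.

Hypothesis sound0 : sound D0.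
(** On the blank tape all flags are 0 without certifying anything; the guard [live] excludes this
    first sweep. *)
Hypothesis U0_sound : live -> forall g, dU D0 g = false -> all_false D0 g.

Lemma value_of_all_false D g : sound D -> all_false D g -> value g.
Proof. by move=> sD af; apply/valueP => n; exact: known_false_sound (af n). Qed.

Lemma sound_stage i : sound (cstage i).2.
Proof.
have gate K : sound (cstage (4 * K)).2 -> sound (cstage (4 * K + 1)).2.
  rewrite cstage_gate /= => -[sT sF sO sC]; split => //= g /leq_writeP [/sT //|[-> /orP [/sT //|]]].
  move=> /andP [l]; rewrite cstage_U_before // => /negbTE u0.
  exact: value_of_all_false sound0 (U0_sound l u0).
have load K : sound (cstage (4 * K)).2 -> sound (cstage (4 * K + 2)).2.
  by move=> /gate; rewrite cstage_load.
have out K : sound (cstage (4 * K)).2 -> sound (cstage (4 * K + 3)).2.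
  move=> /load s; rewrite cstage_out /=; case: s (@known_true_sound _ (wire_src K) s) => sT sF sO sC kt.
  case eo: wire_out => [n|]; last by split.
  have [eg ei] := (wire_outP _ _).1 eo.
  have srcE : source_value (wire_src K) = y n by rewrite /wire_src eg ei check0.
  split => //= [n' /leq_writeP [/sO //|[-> /orP [/sO //|/kt]]]|n' Fn']; first by rewrite srcE.
  rewrite /write; case: eqP => [en|_]; last exact: sC.
  by subst n'; rewrite sC //; case: (y n) srcE kt => //= -> kt; apply/negbTE/negP => /kt.
have wire K : sound (cstage (4 * K)).2 -> sound (cstage (4 * K.+1)).2.
  move=> /[dup] s0 /out s; rewrite cstage_wire /=.
  set D := (cstage (4 * K + 3)).2 in s *.
  case: (s) (@known_true_sound _ (wire_src K) s) => sT sF sO sC kt.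
  split => //= g /leq_writeP [|[eg /orP []]].
  - exact: sF.
  - by rewrite eg => /sF.
  - move=> /kt sv; rewrite eg; apply/negP => /valueP /(_ (wire_index K)).
    by rewrite -/(wire_src K) sv.
  - exact: sC.
  - by rewrite -eg => /sC.
  (* A check gate has just been found false. Via an argument k.+1, the output bit should be 0 and
     [sound_O] keeps it so; via argument 0 it should be 1, and the output slot of the same round has
     just set it. *)
  - move=> /[dup] ktD /kt sv; case ei: (wire_index K) => [|k]; last first.
      move: sv; rewrite /wire_src -eg ei checkS => yg.
      by apply/idP/idP => [/sO|]; rewrite (negbTE yg).
    have yg : y g by rewrite -check0 -ei eg.
    have eo : wire_out K = Some g by apply/wire_outP; rewrite -eg.
    have e3 : dO D g.
      move: ktD; rewrite /D cstage_out /= eo /write eqxx => h.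
      suff -> : known_true (cstage (4 * K + 2)).2 (wire_src K) by rewrite orbT.
      by move: h; case: wire_src.
    by rewrite e3 yg.
have all4 K : sound (cstage (4 * K)).2 by elim: K => [|K /wire//]; rewrite muln0.
have [K [b [b4 ->]]] := div4 i.
by case: b b4 => [|[|[|[|//]]]] _; rewrite ?addn0; [exact: all4|exact/gate/all4|exact/load/all4|exact/out/all4].
Qed.

End Circuit.

Lemma machine_step_input z (c : config machine) : cinput (step z c) = cinput c.
Proof.
case: c => s h ci cw co; rewrite /step /=; case: s => [| | |q o b|q o u d|q k d] /=;
  rewrite ?write_id //; case: ifP => _ //=; rewrite ?write_id //.
by case: interp => [[q' u] d] /=; rewrite write_id.
Qed.

(** * The transfinite run of the circuit machine *)

Section MachineRun.
Variables (kid : nat -> nat -> nat + nat) (wire_out : nat -> option nat).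
Variables (R : ordinal_type) (rk : nat -> R).
Hypothesis rk_lt : forall g n j, kid g n = inl j -> ord_lt (rk j) (rk g).
Variable x : cantor_space.
Variable value : nat -> bool.
Hypothesis valueP : forall g, value g <-> forall n, ~~ source_value x value (kid g n).
Variables (y : cantor_space) (check_gate : nat -> nat).
Hypothesis kid_root : forall n, kid 0 n = inl (check_gate n).
Hypothesis check0 : forall n, source_value x value (kid (check_gate n) 0) = y n.
Hypothesis checkS : forall n k, source_value x value (kid (check_gate n) k.+1) = ~~ y n.
Hypothesis wire_outP : forall K n, wire_out K = Some n <->
  wire_gate K = check_gate n /\ wire_index K = 0.

Local Notation z := (code_tape (schedule kid wire_out)).
Local Notation B := (times_omega R).

Variable c : times_omega B -> config machine.
Hypothesis run_c : is_run z x c.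

Lemma run_input t : cinput (c t) = x.
Proof.
elim/(well_founded_ind (@ord_lt_wf (times_omega B))): t => t ih; have [c0 cS cL] := run_c t.
have [zt|[s st]|lt] := ord_cases t; first by rewrite c0.
  by rewrite (cS s st) machine_step_input ih //; case: st.
rewrite cL //=; apply/funext => n; apply/asboolP/idP => [h|xn r rt].
  have [nz _] := lt; apply: contrapT => nxn; apply: nz => r; apply/negP => /h [s [_ st]].
  by rewrite ih.
by exists r; split => //; [exact: ord_le_refl|rewrite ih].
Qed.

Lemma run_iter (b : B) n : c (tick b n) = iter n (step z) (c (tick b 0)).
Proof.
by elim: n => // n ih; have [_ /(_ _ (tick_succ b n)) -> _] := run_c (tick b n.+1); rewrite ih.
Qed.

Definition data_at (b : B) : data := config_data (c (tick b 0)).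
Definition live_at (b : B) : bool := `[< ~ ord_is_zero b >].
(** Work cell 0 is the flag of gate 0, so at a limit this says that the machine goes on; the first
    sweep is unconditional. *)
Definition running (b : B) := live_at b -> dU (data_at b) 0.
Definition stage_at (b : B) := cstage kid wire_out x (live_at b) (data_at b).

Lemma sweep_start b : running b -> c (tick b 1) =
  @at_block 4 mode MInit interp x (MInit (live_at b)) 0
    (cwork (c (tick b 0))) (coutput (c (tick b 0))) /\
  cstate (c (tick b 0)) <> halt machine.
Proof.
rewrite run_iter [iter _ _ _]/= /running /data_at /live_at; have inp := run_input (tick b 0).
have [c0 _ cL] := run_c (tick b 0).
case: asboolP => [nz|z0] run; last first.
  have zb : ord_is_zero b by apply: contrapT.
  by rewrite c0; [split=> //; exact: start_step|exact: tick_zero].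
have E1 : c (tick b 0) = @Config machine (BLimit 4 mode) 0 x
    (cwork (c (tick b 0))) (coutput (c (tick b 0))).
  by rewrite -inp cL //; exact: tick_limit.
split; last by rewrite E1.
by rewrite {1}E1; apply: limit_step; exact: run.
Qed.

Lemma near_run b n : running b ->
  exists i, near_data (stage_at b i).2 (stage_at b i.+1).2 (c (tick b n)).
Proof.
move=> /sweep_start [c1 nh]; case: n => [|n].
  by exists 0; split => //; move=> j; left.
have [h _] := sweep (schedule_static kid wire_out) x (live_at b) (cwork (c (tick b 0))) (coutput (c (tick b 0))).
by have [i hi] := h n; exists i; rewrite run_iter iterSr -[step _ _](run_iter b 1) c1.
Qed.

Lemma near_run_later b i : running b -> exists N, forall n, N <= n ->
  exists2 i', i <= i' & near_data (stage_at b i').2 (stage_at b i'.+1).2 (c (tick b n)).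
Proof.
move=> /sweep_start [c1 nh].
have [_ h] := sweep (schedule_static kid wire_out) x (live_at b) (cwork (c (tick b 0))) (coutput (c (tick b 0))).
have [N hN] := h i; exists N.+1 => -[//|n] /hN [i' ii' nr]; exists i' => //.
by rewrite run_iter iterSr -[step _ _](run_iter b 1) c1.
Qed.

Lemma limsup_data b : ~ ord_is_zero b -> [/\
  forall g, dU (data_at b) g = limsup_bit (fun s => dU (config_data (c s)) g) (tick b 0),
  forall g, dT (data_at b) g = limsup_bit (fun s => dT (config_data (c s)) g) (tick b 0),
  forall g, dF (data_at b) g = limsup_bit (fun s => dF (config_data (c s)) g) (tick b 0) &
  forall g, dO (data_at b) g = limsup_bit (fun s => dO (config_data (c s)) g) (tick b 0)].
Proof.
move=> nz; have [_ _ cL] := run_c (tick b 0).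
by rewrite /data_at cL //; exact: tick_limit.
Qed.

Lemma lt_tick0 (b : B) t : ord_lt t (tick b 0) -> exists d n, t = tick d n /\ ord_lt d b.
Proof.
have [d [n ->]] := tickP t; rewrite tick_ltE ltn0 andbF orbF => db.
by exists d, n.
Qed.

Definition limit_invariant (b : B) := [/\ sound value y check_gate (data_at b),
  live_at b -> forall g, dU (data_at b) g = false -> all_false kid x (data_at b) g &
  forall d i, ord_lt d b -> data_le (stage_at d i).2 (data_at b)].

Definition running_below (b : B) := forall d, ord_lt d b -> running d.

Section Limit.
Variables (b : B).
Hypothesis b_nz : ~ ord_is_zero b.
Hypothesis b_run : running_below b.
Hypothesis b_inv : forall d, ord_lt d b -> limit_invariant d.

Lemma stage_at_sound d i : ord_lt d b -> sound value y check_gate (stage_at d i).2.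
Proof. by move=> /b_inv [s u _]; exact: (sound_stage valueP check0 checkS wire_outP). Qed.

Lemma stage_at_le d i j : i <= j -> data_le (stage_at d i).2 (stage_at d j).2.
Proof. exact: cstage_le. Qed.

(** [f] stands for [dU], [dT], [dF] or [dO]. Persistence, which needs [f_mono], is applied only to
    the last three. *)
Variable f : data -> cantor_space.
Hypothesis f_near : forall A A' s, near_data A A' s ->
  either (f (config_data s)) (f A) (f A').
Hypothesis f_limsup : forall g, f (data_at b) g = limsup_bit (fun s => f (config_data (c s)) g) (tick b 0).

Lemma limit_true g : f (data_at b) g -> exists2 d, ord_lt d b & exists i, f (stage_at d i).2 g.
Proof.
rewrite f_limsup => /asboolP h.
have [d0 d0b] : exists d, ord_lt d b.
  by apply: contrapT => h'; apply: b_nz => d; apply/negP => db; apply: h'; exists d.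
have [|s [_ sb fs]] := h (tick d0 0); first by rewrite tick_ltE d0b.
have [d [n [es db]]] := lt_tick0 sb; exists d => //; subst s.
have [i nr] := near_run n (b_run db).
by move: fs; case: (f_near nr g) => -> ?; [exists i|exists i.+1].
Qed.

(** The stage after which the bit remains 0 lies in some sweep [d], and the tail of that one sweep
    already shows arbitrarily late stages with value 0. *)
Lemma limit_false g : f (data_at b) g = false -> exists2 d, ord_lt d b &
  forall i, exists2 i', i <= i' & f (stage_at d i').2 g = false.
Proof.
rewrite f_limsup => /asboolPn /existsNP [r /not_implyP [rb nr]].
have [d [m [er db]]] := lt_tick0 rb; subst r; exists d => // i.
have [N hN] := near_run_later i (b_run db).
have [i' ii' nr'] := hN (maxn m N) (leq_maxr _ _).
have fF : f (config_data (c (tick d (maxn m N)))) g = false.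
  apply/negP => ft; apply: nr; exists (tick d (maxn m N)); split => //.
    by rewrite ord_leNlt tick_ltE ord_ltxx eqxx /= -leqNgt leq_maxl.
  by rewrite tick_ltE db.
by move: fF; case: (f_near nr' g) => -> ?; [exists i'|exists i'.+1; rewrite // leqW].
Qed.

Hypothesis f_mono : forall A A' g, data_le A A' -> f A g -> f A' g.

Lemma limit_mono d i g : ord_lt d b -> f (stage_at d i).2 g -> f (data_at b) g.
Proof.
move=> db fi; rewrite f_limsup; apply/asboolP => r rb.
have [N hN] := near_run_later i (b_run db).
(* Later in sweep [d] the bit persists by monotonicity of stages; in a later sweep it is present
   from the start, by the third clause of the invariant. *)
have late s : ord_le (tick d N) s -> ord_lt s (tick b 0) -> f (config_data (c s)) g.
  move=> ds sb; have [d' [n [es d'b]]] := lt_tick0 sb; subst s.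
  move: ds; rewrite ord_leNlt tick_ltE negb_or -ord_leNlt => /andP [dd' h].
  case: (ord_le_eqVlt dd') => [edd|ltdd].
    subst d'; move: h; rewrite eqxx /= -leqNgt => /hN [i' ii' nr].
    by case: (f_near nr g) => ->; apply: f_mono fi; apply: stage_at_le; lia.
  have [i' nr] := near_run n (b_run d'b).
  have [_ _ /(_ d i ltdd) le1] := b_inv d'b.
  have fD : f (stage_at d' 0).2 g by exact: f_mono le1 fi.
  by case: (f_near nr g) => ->; apply: f_mono fD; exact: stage_at_le.
have [rd|dr] := boolP (ord_le r (tick d N)).
  by exists (tick d N); have dN : ord_lt (tick d N) (tick b 0) by [rewrite tick_ltE db]; split => //; apply: late => //; exact: ord_le_refl.
exists r; split => //; first exact: ord_le_refl.
by apply: late => //; apply: ord_ltW; rewrite ord_ltNle.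
Qed.

End Limit.

Lemma near_U A A' s : near_data A A' s -> either (dU (config_data s)) (dU A) (dU A').
Proof. by case. Qed.
Lemma near_T A A' s : near_data A A' s -> either (dT (config_data s)) (dT A) (dT A').
Proof. by case. Qed.
Lemma near_F A A' s : near_data A A' s -> either (dF (config_data s)) (dF A) (dF A').
Proof. by case. Qed.
Lemma near_O A A' s : near_data A A' s -> either (dO (config_data s)) (dO A) (dO A').
Proof. by case. Qed.
Lemma le_T A A' g : data_le A A' -> dT A g -> dT A' g.
Proof. by case=> h _ _; exact: h. Qed.
Lemma le_F A A' g : data_le A A' -> dF A g -> dF A' g.
Proof. by case=> _ h _; exact: h. Qed.
Lemma le_O A A' g : data_le A A' -> dO A g -> dO A' g.
Proof. by case=> _ _ h; exact: h. Qed.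

Lemma limit_invariantP b : running_below b -> limit_invariant b.
Proof.
elim/(well_founded_ind (@ord_lt_wf B)): b => b ih rb.
have ih' d : ord_lt d b -> limit_invariant d.
  by move=> db; apply: ih => // d' d'd; apply: rb; exact: ord_lt_trans db.
have [zb|nz] := pselect (ord_is_zero b).
  have [c0 _ _] := run_c (tick b 0).
  have Db : data_at b = config_data (init_config machine x) by rewrite /data_at c0 //; exact: tick_zero.
  split; rewrite ?Db //; first by rewrite /live_at => /asboolP.
  by move=> d i db; have := zb d; rewrite db.
have [lU lT lF lO] := limsup_data nz.
have le d i : ord_lt d b -> data_le (stage_at d i).2 (data_at b).
  move=> db; split => g.
  - exact: (limit_mono rb ih' near_T lT le_T db).
  - exact: (limit_mono rb ih' near_F lF le_F db).
  - exact: (limit_mono rb ih' near_O lO le_O db).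
have snd d i : ord_lt d b -> sound value y check_gate (stage_at d i).2 by exact: stage_at_sound.
have sO n : dO (data_at b) n -> y n.
  by move=> /(limit_true nz rb near_O lO) [d db [i]]; exact: (sound_O (snd d i db)).
split=> //.
  split=> // [g /(limit_true nz rb near_T lT)|g /(limit_true nz rb near_F lF)|n /(limit_true nz rb near_F lF)] [d db [i fi]].
  - exact: (sound_T (snd d i db)).
  - exact: (sound_F (snd d i db)).
  - have := sound_check (snd d i db) fi; case: (boolP (y n)) => [yn|nyn] oi.
      by have [_ _ h] := le d i db; apply: h; rewrite oi.
    by apply/negP => /sO; rewrite (negbTE nyn).
(* Each argument was found false during the single sweep [d], and this knowledge persists to [b];
   successors and limits of sweeps need no distinction. *)
move=> _ g /(limit_false rb near_U lU) [d db h] n.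
have [i kf] := cstage_unmarked h n.
exact: known_false_le (le d i db) kf.
Qed.

(** After the clearing in round [g] no wire sets the flag again. The next sweep must be a successor:
    at a limit of sweeps, flags set cofinally often reappear. *)
Lemma all_false_unmarked b b' g : ord_is_succ b b' -> running_below b -> running b ->
  all_false kid x (data_at b) g -> dU (data_at b') g = false.
Proof.
move=> [bb' hb] rb r af; have nz : ~ ord_is_zero b' by move=> /(_ b); rewrite bb'.
have [lU _ _ _] := limsup_data nz; rewrite lU; apply/asboolP => h.
have [N hN] := near_run_later (4 * g).+1 r.
have [|s [ls sb us]] := h (tick b N); first by rewrite tick_ltE bb'.
have [d [n [es db]]] := lt_tick0 sb; subst s.
move: ls; rewrite ord_leNlt tick_ltE negb_or -ord_leNlt => /andP [bd h'].
have ed : d = b by apply: ord_le_anti => //; exact: hb.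
subst d; move: h'; rewrite eqxx /= -leqNgt => /hN [i' ii' nr].
have e1 := cstage_all_false wire_out (live_at b) af ii'.
have e2 := cstage_all_false wire_out (live_at b) af (leqW ii').
by move: us; case: (near_U nr g) => ->; rewrite ?e1 ?e2.
Qed.

Lemma tickS_live (r : R) n : live_at (tick r n.+1).
Proof. by apply/asboolP => /(_ (tick r n)); case: (tick_succ r n) => ->. Qed.

Lemma value_root : value 0.
Proof.
apply/valueP => n; rewrite kid_root /=; apply/negP => /valueP h.
have := h 0; rewrite check0 => ny; have := h 1; rewrite checkS.
by rewrite ny.
Qed.

(** If the machine never stopped, then by induction on rank sweep [tick (rk g) 0] would meet known
    arguments and either set [dF] or leave the flag of [g] at 0. The root is true, so its flag would
    be 0, which is the halting condition. *)
Lemma halting_exists : exists b, ~ running b.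
Proof.
apply: contrapT => nex; have run b : running b by apply: contrapT => nr; apply: nex; exists b.
have rb b : running_below b by move=> d _.
have inv b := limit_invariantP (rb b).
suff decided g : dF (data_at (tick (rk g) 1)) g \/ dU (data_at (tick (rk g) 1)) g = false.
  have [Fr|h] := decided 0.
    have [s _ _] := inv (tick (rk 0) 1).
    by have := sound_F s Fr; rewrite value_root.
  by have := run (tick (rk 0) 1) (tickS_live _ _); rewrite h.
have [r] : exists r, r = rk g by exists (rk g).
elim/(well_founded_ind (@ord_lt_wf R)): r g => r ih g er.
have [_ u0 _] := inv (tick r 0).
have le0 d i : ord_lt d (tick r 0) -> data_le (stage_at d i).2 (data_at (tick r 0)).
  by have [_ _ h] := inv (tick r 0); exact: h.
have [[n kt]|nkt] := pselect (exists n, known_true x (data_at (tick r 0)) (kid g n)).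
  have [i Fi] := cstage_kid_true wire_out (live_at (tick r 0)) kt.
  have [_ _ le1] := inv (tick r 1); left; rewrite -er.
  exact: le_F (le1 (tick r 0) i (proj1 (tick_succ r 0))) Fi.
right; rewrite -er; apply: all_false_unmarked (tick_succ r 0) (rb _) (run _) _ => n.
have nk : ~~ known_true x (data_at (tick r 0)) (kid g n) by apply/negP => kt; apply: nkt; exists n.
case ek: (kid g n) nk => [j|i] //= nT.
have jr : ord_lt (rk j) r by rewrite er; exact: rk_lt ek.
have t1 : ord_lt (tick (rk j) 1) (tick r 0) by rewrite tick_ltE jr.
case: (ih _ jr j erefl) => [Fj|Uj]; first exact: le_F (le0 _ 0 t1) Fj.
(* A flag 0 at [tick (rk j) 1] makes that very sweep set [dT] of [j], in time for [tick r 0]. *)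
case/negP: nT; apply: le_T (le0 _ _ t1) _.
exact: (cstage_gate_true _ _ _ (tickS_live _ _) Uj).
Qed.

Lemma circuit_halts : exists t : times_omega B, halts_at machine z x t y.
Proof.
have [b [nb minb]] := ord_min halting_exists.
have rb : running_below b.
  move=> d db; apply: contrapT => nd; have := minb d nd.
  by rewrite ord_leNlt db.
have [sb ub _] := limit_invariantP rb.
have lb : live_at b by apply: contrapT => nl; apply: nb.
have u0 : dU (data_at b) 0 = false by apply/negP => u; apply: nb.
have nz : ~ ord_is_zero b by move/asboolP: lb.
have cb0 : c (tick b 0) = @Config machine (BLimit 4 mode) 0 x
    (cwork (c (tick b 0))) (coutput (c (tick b 0))).
  rewrite -(run_input (tick b 0)); have [_ _ cL] := run_c (tick b 0).
  by rewrite cL //; exact: tick_limit.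
have cb1 : c (tick b 1) = @Config machine (BHalt 4 mode) 0 x
    (cwork (c (tick b 0))) (coutput (c (tick b 0))).
  by rewrite run_iter [iter _ _ _]/= {1}cb0; apply: limit_halt; exact: u0.
exists (tick b 1), c; split; rewrite ?cb1 //.
  move=> s; have [d [n ->]] := tickP s.
  rewrite tick_ltE ltnS leqn0 => /orP [db|/andP [/eqP -> /eqP ->]]; last by rewrite cb0.
  by have [i []] := near_run n (rb d db).
(* The root flag 0 certifies that every check gate is known false, so each output bit is final. *)
apply/funext => n /=; rewrite -(sound_check sb) //.
by have := ub lb 0 u0 n; rewrite kid_root.
Qed.

End MachineRun.

(** * Borel codes *)

Inductive bcode := Inp of nat | Nor of (nat -> bcode).

Fixpoint eval (k : bcode) (x : cantor_space) : bool :=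
  match k with Inp i => x i | Nor f => `[< forall n, ~~ eval (f n) x >] end.

Definition coded (A : set cantor_space) := exists k, forall x, A x <-> eval k x.

Lemma coded_nor (A : nat -> set cantor_space) :
  (forall n, coded (A n)) -> coded [set x | forall n, ~ A n x].
Proof.
move=> /choice [k kP]; exists (Nor k) => x /=; split=> [h|/asboolP h n].
  by apply/asboolP => n; apply/negP => /kP; exact: h.
by move=> /kP; exact/negP/h.
Qed.

Lemma codedC (A : set cantor_space) : coded A -> coded (~` A).
Proof.
move=> cA; have [k kP] := coded_nor (fun _ : nat => cA).
exists k => x; rewrite -kP; split=> [nA n|]; first exact: nA.
by move=> /(_ 0).
Qed.

Lemma coded_forall (A : nat -> set cantor_space) :
  (forall n, coded (A n)) -> coded [set x | forall n, A n x].
Proof.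
move=> cA; have [k kP] := coded_nor (fun n => codedC (cA n)).
exists k => x; rewrite -kP; split=> h n; first by move/(_ (h n)).
by apply: contrapT; exact: h.
Qed.

Lemma coded_exists (A : nat -> set cantor_space) :
  (forall n, coded (A n)) -> coded [set x | exists n, A n x].
Proof.
move=> /coded_nor /codedC [k kP]; exists k => x; rewrite -kP.
split=> [[n An] h|h]; first exact: h An.
by apply: contrapT => nA; apply: h => n An; apply: nA; exists n.
Qed.

Lemma coded_coord i b : coded [set x | x i = b].
Proof.
have ci : coded [set x | x i] by exists (Inp i).
case: b => //; have [k kP] := codedC ci; exists k => x; rewrite -kP.
by split=> [/= -> //|/negP/negbTE].
Qed.

Lemma codedT (P : Prop) : coded [set x | P].
Proof.
have [k kP] : coded setT.
  have c0 := coded_coord 0 true.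
  have [|k kP] := @coded_exists (fun n => if n is 0 then [set x | x 0 = true] else ~` [set x | x 0 = true]).
    by case=> [//|_]; exact: codedC.
  exists k => x; rewrite -kP; split=> // _.
  by have [x0|nx0] := pselect (x 0 = true); [exists 0|exists 1].
have [p|np] := pselect P; first by exists k => x; rewrite -kP.
have [k' kP'] := codedC (ex_intro _ k kP).
exists k' => x; rewrite -kP'; split=> [/np//|h].
by case: h.
Qed.

Lemma coded_imp (P : Prop) (A : set cantor_space) : coded A -> coded [set x | P -> A x].
Proof.
move=> [k kP]; have [p|np] := pselect P.
  by exists k => x; rewrite -kP; split=> [|? //]; exact.
have [k' kP'] := codedT True; exists k' => x; rewrite -kP'.
by split=> // _ /np.
Qed.

Lemma coded_open (U : set cantor_space) : open U -> coded U.
Proof.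
move=> oU.
pose cyl (s : seq bool) : set cantor_space := [set y | forall i, i < size s -> y i = nth false s i].
pose dec n : seq bool := odflt [::] (unpickle n).
have decK s : dec (pickle s) = s by rewrite /dec pickleK.
(* Index 0 says that the cylinder lies in [U], the other indices that [x] lies in the cylinder;
   their conjunction is thus a countable intersection. *)
pose V (n : nat) : set cantor_space := [set x | forall m : nat,
  if m is m'.+1 then forall i, i < size (dec n) -> x i = nth false (dec n) i
  else cyl (dec n) `<=` U].
have cV n : coded (V n).
  apply: coded_forall => -[|m]; first exact: codedT.
  apply: coded_forall => i; apply: coded_imp; exact: coded_coord.
have [k kP] := coded_exists cV; exists k => x; rewrite -kP; split=> [Ux|[n Vn]].
  have [n hn] := open_cylinder oU Ux; exists (pickle (mkseq x n)) => -[|_].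
    rewrite decK => v; rewrite /cyl /= size_mkseq => h.
    by apply: hn => i ilt; rewrite h // nth_mkseq.
  by rewrite decK size_mkseq => i ilt; rewrite nth_mkseq.
exact: (Vn 0) (Vn 1).
Qed.

Lemma coded_borel (A : set cantor_space) : borel_set A -> coded A.
Proof.
apply: smallest_sub; last exact: coded_open.
split; first exact: (codedT False).
  by move=> C /codedC [k kP]; exists k => x; rewrite -kP; split=> [[]|].
move=> F /coded_exists [k kP]; exists k => x; rewrite -kP.
by split=> [[n _ Fn]|[n Fn]]; exists n.
Qed.

(* The Kleene-Brouwer ordering of the tree of subcodes. *)
Fixpoint brank (k : bcode) : ordinal_type :=
  match k with
  | Inp _ => ord_one
  | Nor f => lex_sum (fun o : succ_omega => if o is Some n then brank (f n) else ord_one)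
  end.

Lemma countable_one : countable_ordinal ord_one.
Proof. exact: countableP. Qed.

Lemma rank_countable k : countable_ordinal (brank k).
Proof.
elim: k => [i|f ih]; first exact: countable_one.
apply: lex_sum_countable => [|[n|]]; [exact: countableP|exact: ih|exact: countable_one].
Qed.

(** The place of a path in the Kleene-Brouwer order: [None], the top index, puts a node after all
    its subtrees. Paths are cut off at leaves. *)
Fixpoint node (k : bcode) (s : seq nat) : brank k :=
  match k return brank k with
  | Inp _ => tt
  | Nor f =>
      let X := fun o : succ_omega => if o is Some n then brank (f n) else ord_one in
      match s with
      | [::] => existT X None tt
      | n :: s' => existT X (Some n) (node (f n) s')
      end
  end.

Fixpoint subcode (k : bcode) (s : seq nat) : bcode :=
  match k, s with Nor f, n :: s' => subcode (f n) s' | _, _ => k end.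

Lemma subcode_rcons k s f n : subcode k s = Nor f -> subcode k (rcons s n) = f n.
Proof.
elim: k s => [i [|m s]|h ih [|m s]] //=; first by move=> [->]; case: (f n).
exact: ih.
Qed.

(** An inner node is required: beyond a leaf, a path and its extensions denote the same point. *)
Lemma node_lt k s f n : subcode k s = Nor f -> ord_lt (node k (rcons s n)) (node k s).
Proof.
pose X h (o : succ_omega) := if o is Some n then brank (h n) else ord_one.
elim: k s => [i [|m s] //|h ih [|m s]].
  by move=> _; exact: (@lex_sum_lt succ_omega (X h) (Some n) None (node (h n) [::]) tt isT).
move=> /ih lt; rewrite -(@lex_sum_lt_fiber succ_omega (X h) (Some m)) in lt.
exact: lt.
Qed.

Section CodeCircuit.
Variable k : bcode.

(* Gate [g] computes the subcode at the path numbered [g]; gates whose path ends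
   at an input bit are never read, and get a dummy argument. *)
Definition code_kid (g n : nat) : nat + nat :=
  let s := CodeSeq.decode g in
  match subcode k s with
  | Inp _ => inr 0
  | Nor f => if f n is Inp i then inr i else inl (CodeSeq.code (rcons s n))
  end.

(** The second case is the NOR of the dummy argument, input bit 0, so that the gate equation holds
    at every number. *)
Definition code_value (x : cantor_space) (g : nat) : bool :=
  if subcode k (CodeSeq.decode g) is Nor f then eval (Nor f) x else ~~ x 0.

Definition code_rank (g : nat) : brank k := node k (CodeSeq.decode g).

Lemma code_rank_lt g n j : code_kid g n = inl j -> ord_lt (code_rank j) (code_rank g).
Proof.
rewrite /code_kid /code_rank; case e: subcode => [//|f].
by case: (f n) => // _ [<-]; rewrite CodeSeq.codeK; exact: node_lt e.
Qed.

Lemma code_kid_value x g f n : subcode k (CodeSeq.decode g) = Nor f ->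
  source_value x (code_value x) (code_kid g n) = eval (f n) x.
Proof.
move=> e; rewrite /code_kid e; have := subcode_rcons n e.
case ef: (f n) => [//|h] /= e'; rewrite /code_value CodeSeq.codeK e'.
by [].
Qed.

Lemma code_valueP x g :
  code_value x g <-> forall n, ~~ source_value x (code_value x) (code_kid g n).
Proof.
case e: (subcode k (CodeSeq.decode g)) => [i|f].
  by rewrite /code_value /code_kid e /=; split=> [|/(_ 0)].
under eq_forall do rewrite (code_kid_value x _ e).
by rewrite /code_value e /=; split=> /asboolP.
Qed.

End CodeCircuit.

(** A path of length one leads to a check gate, whose argument 0 computes the output bit. *)
Definition wire_out (K : nat) : option nat :=
  if wire_index K == 0 then
    if CodeSeq.decode (wire_gate K) is [:: n] then Some n else None
  else None.

Lemma wire_outP K n : wire_out K = Some n <->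
  wire_gate K = CodeSeq.code [:: n] /\ wire_index K = 0.
Proof.
rewrite /wire_out -{2}(CodeSeq.decodeK (wire_gate K)).
split=> [|[/(can_inj CodeSeq.codeK) -> ->]//].
case: eqP => // ->; case: (CodeSeq.decode _) => [|m [|? ?]] //= [->].
by [].
Qed.

Lemma program_of_borel_fun (f : cantor_space -> cantor_space) : borel_fun f ->
  exists (e : program) (z : cantor_space) (a : ordinal_type),
    [/\ countable_ordinal a, computes e z f & forall x, halts_before e z x a].
Proof.
move=> bf; have /choice [cf cfP] n : coded [set x | f x n].
  by apply: coded_borel; exact: borel_fun_borel.
(* No gate [check n] is true, but it can only be found false once [f x n] is
   known; hence the root is found true when the whole output is known. *)
pose check n := Nor (fun m => if m is 0 then cf n else Nor (fun=> cf n)).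
pose root := Nor check.
have evalE x n : eval (cf n) x = f x n by apply/idP/idP => /cfP.
pose a := times_omega (times_omega (brank root)).
have halts x : exists t : a, halts_at machine (code_tape (schedule (code_kid root) wire_out)) x t (f x).
  have [c run_c] := run_exists machine (code_tape (schedule (code_kid root) wire_out)) x a.
  (* The path [[:: n]] leads to [check n]; the root has the empty path, whose code is 0. *)
  pose g n := CodeSeq.code [:: n].
  have subg n : subcode root (CodeSeq.decode (g n)) = check n by rewrite CodeSeq.codeK.
  apply: (@circuit_halts (code_kid root) wire_out _ (code_rank root) (@code_rank_lt root) x
    (code_value root x) (code_valueP root x) (f x) g _ _ _ wire_outP c run_c).
  - by [].
  - by move=> n; rewrite (code_kid_value x _ (subg n)).
  - move=> n m; rewrite (code_kid_value x _ (subg n)) /= evalE.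
    by apply/asboolP/idP => [/(_ 0)|].
exists machine, (code_tape (schedule (code_kid root) wire_out)), a; split.
- by apply/times_omega_countable/times_omega_countable/rank_countable.
- by move=> x; have [t ht] := halts x; exists a, t.
- by move=> x; have [t ht] := halts x; exists t, (f x).
Qed.

Theorem theorem2p1 :
  (forall A : set cantor_space,
     borel_set A <->
     exists (e : program) (z : cantor_space) (a : ordinal_type),
       [/\ countable_ordinal a,
           decides e z A &
           forall x : cantor_space, halts_before e z x a])
  /\
  (forall f : cantor_space -> cantor_space,
     borel_fun f <->
     exists (e : program) (z : cantor_space) (a : ordinal_type),
       [/\ countable_ordinal a,
           computes e z f &
           forall x : cantor_space, halts_before e z x a]).
Proof.
have main f : borel_fun f <-> exists (e : program) (z : cantor_space) (a : ordinal_type),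
    [/\ countable_ordinal a, computes e z f & forall x, halts_before e z x a].
  split; first exact: program_of_borel_fun.
  by move=> [e [z [a [ca cf hb]]]]; exact: borel_fun_of_program ca cf hb.
by split=> // A; rewrite borel_char_fun; exact: main.
Qed.
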